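(* Let $\{\nu_r\mid r\in\mathbb R\}$ be a family of Borel probability measures on $X$ forming an evolution system of measures with respect to $\{P_{s,t}\mid s<t\}$, i.e. $\int_XP_{s,t}\varphi\,d\nu_s=\int_X\varphi\,d\nu_t$ for all $s<t$ and $\varphi\in C_b(X)$. Fix $t\in\mathbb R$ and assume that there exists $K>0$ such that $$\sup_{r\le t}\int_X|x|_X^K\,\nu_r(dx)<+\infty.$$ Then $\nu_t=\mu_t$, where $\mu_t:=\mathcal N(0,Q(t,-\infty))$.
   Context: $X$ is a separable real Hilbert space with inner product $\langle\cdot,\cdot\rangle_X$ and norm $|\cdot|_X$; $\mathcal L(X)$ is the space of bounded linear operators on $X$. $\{A(t)\}_{t\in\mathbb R}$ is a family of linear operators $A(t):D(A(t))\subseteq X\to X$ generating a strongly continuous evolution operator $\{U(t,s):s\le t\}\subseteq\mathcal L(X)$, i.e. $\partial_tU(t,s)=A(t)U(t,s)$ for $s<t$, $U(t,s)=U(t,r)U(r,s)$ for $s\le r\le t$, $U(\tau,\tau)=I$, and $(t,s)\mapsto U(t,s)x$ is continuous on $\{s\le t\}$ for every $x\in X$. The set $\Omega_U:=\{\omega\in\mathbb R:\exists M>0,\ \|U(t,s)\|_{\mathcal L(X)}\le Me^{\omega(t-s)}\ \forall s\le t\}$ is non-empty and $\omega_0:=\inf\Omega_U<0$. $\{B(t)\}_{t\in\mathbb R}\subseteq\mathcal L(X)$ is bounded in operator norm and $t\mapsto B(t)x$ is measurable for every $x\in X$. For $s\le t$ set $Q(t,s):=\int_s^tU(t,r)B(r)B(r)^*U(t,r)^*\,dr$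 and $Q(t,-\infty):=\int_{-\infty}^tU(t,r)B(r)B(r)^*U(t,r)^*\,dr$. Standing assumptions: every $Q(t,s)$ is trace class and $\sup_{s\le t}\mathrm{tr}\,Q(t,s)<+\infty$ for every $t$ (which implies that $Q(t,-\infty)$ is trace class); controllability: $\mathrm{Im}\,U(t,s)\subseteq \mathrm{Im}\,Q(t,s)^{1/2}$ for all $s<t$. $\mathcal N(a,Q)$ denotes the (possibly degenerate) Gaussian measure on $X$ with mean $a$ and covariance $Q$. $C_b(X)$ is the space of bounded continuous functions on $X$, and $[P_{s,t}\varphi](x):=\int_X\varphi(U(t,s)x+y)\,\mathcal N(0,Q(t,s))(dy)$ for $\varphi\in C_b(X)$, $s\le t$. *)

(* Defs.v *)
From HB Require Import structures.
From mathcomp Require Import all_boot all_order all_algebra.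
From mathcomp Require Import sesquilinear.
From mathcomp Require Import all_classical all_reals all_analysis.

Set Implicit Arguments.
Unset Strict Implicit.
Unset Printing Implicit Defensive.

Import Order.TTheory GRing.Theory Num.Theory.
Import numFieldNormedType.Exports.

Local Open Scope classical_set_scope.
Local Open Scope ring_scope.

Section hilbert.
Context {R : realType} {X : completeNormedModType R}.

Definition separable := exists2 D : set X, countable D & dense D.

(* The norm of X is the one induced by the form; together with the completeness
   of X, this makes (X, ip) a real Hilbert space. *)
Definition inner_product_of_norm (ip : {dot X for idfun}) :=
  forall x, ip x x = `|x| ^+ 2.

Definition opnorm (T : X -> X) : R := sup [set `|T x| | x in [set x | `|x| <= 1]].

Variable ip : {dot X for idfun}.

(* Unique, and existing by Riesz' theorem, when T is linear and continuous. *)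
Definition adjoint (T : X -> X) : X -> X :=
  xget (cst 0) [set S | forall x y, ip (T x) y = ip x (S y)].

(* Linearity and continuity follow from symmetry (Hellinger-Toeplitz). *)
Definition nonneg_selfadjoint (T : X -> X) :=
  (forall x y, ip (T x) y = ip x (T y)) /\ (forall x, 0 <= ip (T x) x).

(* The unique nonnegative square root of a nonnegative self-adjoint T. *)
Definition opsqrt (T : X -> X) : X -> X :=
  xget (cst 0) [set S | nonneg_selfadjoint S /\ S \o S = T].

(* The basis is indexed by itself, so that dim X < oo and X = {0} are covered. *)
Definition orthonormal_basis (E : set X) :=
  (forall x y, E x -> E y -> ip x y = (x == y)%:R) /\
  (forall x, (forall e, E e -> ip x e = 0) -> x = 0).

Definition basis : set X := xget set0 orthonormal_basis.

(* Only meaningful for nonnegative T, for which it is basis independent. *)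
Definition trace (T : X -> X) : \bar R := \esum_(e in basis) (ip (T e) e)%:E.

(* The trace of |T| = (T^* T)^(1/2) is finite. *)
Definition trace_class (T : X -> X) :=
  (trace (opsqrt (adjoint T \o T)) < +oo)%E.

(* Integral over D of an X-valued function, in the weak sense: the vector v such
   that <v, y> is the integral of <f r, y>, for all y. *)
Definition vintegral (D : set R) (f : R -> X) : X :=
  xget 0 [set v | forall y,
    (@lebesgue_measure R).-integrable D (fun r => (ip (f r) y)%:E) /\
    ip v y = \int[@lebesgue_measure R]_(r in D) (ip (f r) y)].

End hilbert.

Section borel.
Context {R : realType} (X : completeNormedModType R).

Definition borel := g_sigma_algebraType (@open X).

End borel.

Section gaussian.
Context {R : realType} {X : completeNormedModType R}.

(* The normal distribution on R of mean m and variance v; the degenerate case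
   needs care because [normal_prob m 0] is not the Dirac mass at m. *)
Definition normal_law (m v : R) : set (measurableTypeR R) -> \bar R :=
  if v == 0 then \d_m else normal_prob m (Num.sqrt v).

(* mu is N(a, Q): the law of each <., h> is normal with mean <a, h> and variance
   <Q h, h>. *)
Definition is_gaussian (ip : {dot X for idfun}) (mu : probability (borel X) R)
    (a : X) (Q : X -> X) :=
  nonneg_selfadjoint ip Q /\
  forall (h : X) (V : set (measurableTypeR R)), measurable V ->
    pushforward mu (fun x : borel X => ip x h : measurableTypeR R) V =
    normal_law (ip a h) (ip (Q h) h) V.

End gaussian.

Section evolution.
Context {R : realType} {X : completeNormedModType R}.
Variable ip : {dot X for idfun}.
Variable U : R -> R -> X -> X.

Definition linear_on_domain (D : set X) (A : X -> X) :=
  D 0 /\ forall (k : R) x y, D x -> D y ->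
    D (k *: x + y) /\ A (k *: x + y) = k *: A x + A y.

(* The values [U t s] for t < s are irrelevant, as is [A t] outside its domain. *)
Definition evolution_operator :=
  [/\ (forall s t, s <= t -> continuous (U t s)),
      (forall s r t, s <= r -> r <= t -> U t s = U t r \o U r s),
      (forall r, U r r = id) &
      (forall x, {within [set p : R * R | p.2 <= p.1],
         continuous (fun p : R * R => U p.1 p.2 x)})].

Definition generates (domA : R -> set X) (A : R -> X -> X) :=
  forall s t x, s < t ->
    domA t (U t s x) /\
    is_derive (t : R^o) (1 : R^o) (fun r : R^o => U r s x) (A t (U t s x)).

Definition growth_rates : set R :=
  [set w | exists2 M, 0 < M &
    forall s t, s <= t -> opnorm (U t s) <= M * expR (w * (t - s))].

Variable B : R -> X -> X.

Definition cov_integrand (t r : R) (x : X) : X :=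
  U t r (B r (adjoint ip (B r) (adjoint ip (U t r) x))).

Definition Qop (t s : R) (x : X) : X :=
  vintegral ip `[s, t] (fun r => cov_integrand t r x).

Definition Qop_ninfty (t : R) (x : X) : X :=
  vintegral ip `]-oo, t] (fun r => cov_integrand t r x).

Definition Cb (phi : X -> R) :=
  continuous phi /\ exists C, forall x, `|phi x| <= C.

(* gam t s stands for N(0, Q(t, s)). *)
Definition transition (gam : R -> R -> probability (borel X) R) (s t : R)
    (phi : X -> R) (x : X) : R :=
  \int[gam t s]_(y in [set: borel X]) phi (U t s x + y).

Definition evolution_system_of_measures
    (gam : R -> R -> probability (borel X) R)
    (nu : R -> probability (borel X) R) :=
  forall s t, s < t -> forall phi, Cb phi ->
    \int[nu s]_(x in [set: borel X]) transition gam s t phi x =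
    \int[nu t]_(x in [set: borel X]) phi x.

End evolution.

(* Main.v *)
Require Import Defs.
From HB Require Import structures.
From mathcomp Require Import all_boot all_order all_algebra.
From mathcomp Require Import sesquilinear ring lra.
From mathcomp Require Import all_classical all_reals all_analysis measurable_realfun.

(** The measure nu_t is identified through its one-dimensional marginals, and
    these through the limit s -> -oo in the identity
      int (P_{s,t} phi) d(nu_s) = int phi d(nu_t).

    Take phi(x) = g <x, h> with g an L-Lipschitz function of a real variable with
    values in [-1, 1].  Then P_{s,t} phi (x) is the integral of
    g (<U(t,s)x, h> + <y, h>) against N(0, Q(t,s))(dy), which differs from the same
    integral at x = 0 by at most min(L |<U(t,s)x, h>|, 2).  By exponential
    stability |<U(t,s)x, h>| is at most D_s |x| with D_s -> 0, and the moments of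
    order K of nu_s are bounded uniformly in s, so a Markov-type estimate makes the
    nu_s-mean of this error vanish ([transition_gap]).  Hence int phi d(nu_t) is the
    limit of the integrals of g against the one-dimensional normal laws of variance
    <Q(t,s)h, h>.  These variances increase to <Q(t,-oo)h, h> ([cvg_Qop]), and
    normal laws depend continuously on their variance ([cvg_normal_law]);
    therefore int phi d(nu_t) is the integral of g against
    N(0, <Q(t,-oo)h, h>) ([evolution_marginal]).

    Two uniqueness statements turn this into the theorem: a law on R is determined
    by the integrals of cos (c z) and sin (c z), which gives the marginals of
    nu_t, and a Borel law on X is determined by the integrals of cos <x, h> and
    sin <x, h>, which gives uniqueness of the Gaussian measure.  Both are instances
    of [fourier_unique].  Say that a bounded function F is good when the two
    measures agree on all the products F cos f and F sin f.  The bounded functions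
    that map good functions to good functions by multiplication form an algebra
    that contains every cos f and sin f and is stable under bounded pointwise
    limits.  Iterating u |-> u (3 - u^2) / 2 produces the sign of any member with
    values in [-1, 1], so the algebra contains the indicators of the half-spaces
    a < f, hence those of all the sets that they generate.

    The covariance operators are weak integrals, so their existence has to be
    established.  It rests on the Riesz representation theorem, proved by minimizing
    <x, x> - 2 f(x) ([riesz_representation]), and on the measurability of inner
    products of weakly measurable functions, a consequence of separability
    ([weakly_measurable_ip]). *)

Set Implicit Arguments.
Unset Strict Implicit.
Unset Printing Implicit Defensive.

Import Order.TTheory GRing.Theory Num.Theory.
Import numFieldNormedType.Exports.

Local Open Scope classical_set_scope.
Local Open Scope ring_scope.

(** * Integration of bounded functions *)

Section integration.
Context d (T : measurableType d) (R : realType).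

Lemma dominated_Rintegral (mu : {measure set T -> \bar R}) (D : set T)
    (F_ : nat -> T -> R) (F g : T -> R) :
  measurable D ->
  (forall n, measurable_fun D (F_ n)) ->
  (forall x, D x -> F_ ^~ x @ \oo --> F x) ->
  mu.-integrable D (EFin \o g) ->
  (forall n x, D x -> `|F_ n x| <= g x) ->
  \int[mu]_(x in D) F_ n x @[n --> \oo] --> \int[mu]_(x in D) F x.
Proof.
move=> mD mF_ F_F ig F_g.
have mF : measurable_fun D F by exact: (measurable_fun_cvg mF_ F_F).
have [|||||iF _ cvgI] := @dominated_convergence _ _ _ mu D mD
    (fun n => EFin \o F_ n) (EFin \o F) (EFin \o g) => //.
- by move=> n; exact/measurable_EFinP.
- exact/measurable_EFinP.
- apply: aeW => x Dx; apply: cvg_EFin; first exact: nearW.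
  exact: F_F.
- by apply: aeW => x n Dx; rewrite lee_fin F_g.
apply: fine_cvg; rewrite fineK; first exact: cvgI.
exact: integrable_fin_num.
Qed.

Definition bounded_measurable (F : T -> R) :=
  measurable_fun setT F /\ exists C, forall x, `|F x| <= C.

Lemma bounded_measurable_integrable (P : probability T R) F :
  bounded_measurable F -> P.-integrable setT (EFin \o F).
Proof.
move=> [mF [C FC]]; apply: measurable_bounded_integrable => //.
  exact: le_lt_trans (probability_le1 P measurableT) (ltry _).
exists C; split; first by rewrite num_real.
by move=> M CM x _; exact: le_trans (FC x) (ltW CM).
Qed.

Lemma bounded_measurable_cst c : bounded_measurable (cst c).
Proof. by split=> //; exists `|c|. Qed.

Lemma bounded_measurableD F G : bounded_measurable F -> bounded_measurable G ->
  bounded_measurable (fun x => F x + G x).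
Proof.
move=> [mF [C FC]] [mG [C' GC]]; split; first exact: measurable_funD.
by exists (C + C') => x; rewrite (le_trans (ler_normD _ _))// lerD.
Qed.

Lemma bounded_measurableM F G : bounded_measurable F -> bounded_measurable G ->
  bounded_measurable (fun x => F x * G x).
Proof.
move=> [mF [C FC]] [mG [C' GC]]; split; first exact: measurable_funM.
by exists (C * C') => x; rewrite normrM ler_pM.
Qed.

Lemma sin_abs_le1 (x : R) : `|sin x| <= 1.
Proof. by rewrite ler_norml sin_geN1 sin_le1. Qed.

Lemma bounded_measurable_cos f : measurable_fun setT f ->
  bounded_measurable (fun x => cos (f x)).
Proof.
move=> mf; split; last by exists 1 => x; exact: cos_max.
apply: measurableT_comp => //; apply: continuous_measurable_fun.
exact: continuous_cos.
Qed.

Lemma bounded_measurable_sin f : measurable_fun setT f ->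
  bounded_measurable (fun x => sin (f x)).
Proof.
move=> mf; split; last by exists 1 => x; exact: sin_abs_le1.
apply: measurableT_comp => //; apply: continuous_measurable_fun.
exact: continuous_sin.
Qed.

Lemma bounded_Rintegral_cvg (P : probability T R) (F_ : nat -> T -> R) F C :
  (forall n, measurable_fun setT (F_ n)) ->
  (forall n x, `|F_ n x| <= C) ->
  (forall x, F_ ^~ x @ \oo --> F x) ->
  \int[P]_x F_ n x @[n --> \oo] --> \int[P]_x F x.
Proof.
move=> mF_ F_C F_F; apply: (dominated_Rintegral (g := cst C)) => //.
exact: bounded_measurable_integrable (bounded_measurable_cst C).
Qed.

Lemma Rintegral_lin (m : probability T R) a b F G :
  bounded_measurable F -> bounded_measurable G ->
  \int[m]_x (a * F x + b * G x) = a * \int[m]_x F x + b * \int[m]_x G x.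
Proof.
move=> bF bG.
have bM c K : bounded_measurable K -> bounded_measurable (fun x : T => c * K x).
  exact: bounded_measurableM (bounded_measurable_cst _).
rewrite RintegralD//; try exact/bounded_measurable_integrable/bM.
by rewrite !RintegralZl//; exact: bounded_measurable_integrable.
Qed.

End integration.

Lemma Rintegral_probability_cst d (T : measurableType d) (R : realType)
    (P : probability T R) (c : R) : \int[P]_x cst c x = c.
Proof.
have PT : P [set: T] = 1%E := probability_setT P.
by rewrite Rintegral_cst// [X in fine X]PT mulr1.
Qed.

Lemma Rintegral_norm_le d (T : measurableType d) (R : realType)
    (P : probability T R) F C :
  bounded_measurable F -> (forall x, `|F x| <= C) -> `|\int[P]_x F x| <= C.
Proof.
move=> bF FC; have iF := bounded_measurable_integrable P bF.
apply: le_trans (le_normr_Rintegral _ iF) _ => //.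
apply: (@le_trans _ _ (\int[P]_x cst C x)).
  apply: le_Rintegral => //; first exact: integrable_norm.
  exact: bounded_measurable_integrable (bounded_measurable_cst _ _).
by rewrite Rintegral_probability_cst.
Qed.

Lemma integrable_EFinZr d (T : measurableType d) (R : realType)
    (mu : {measure set T -> \bar R}) (D : set T) (f : T -> R) (c : R) :
  measurable D -> mu.-integrable D (EFin \o f) ->
  mu.-integrable D (EFin \o (fun x => f x * c)).
Proof.
move=> mD fi; have -> : EFin \o (fun x => f x * c) = ((EFin \o f) \* cst c%:E)%E.
  by apply/funext => x /=; rewrite EFinM.
exact: integrableZr.
Qed.

(** * Pointwise approximation of the sign function *)

Section sign.
Context {R : realType}.

(** The fixed points of this map are 0, 1 and -1, and it moves every other point of
    [-1, 1] towards the endpoint of the same sign: its iterates are polynomials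
    converging boundedly to the sign on [-1, 1]. *)
Definition sign_step (u : R) : R := u * (3 - u ^+ 2) / 2.

Lemma sign_step_bound u : `|u| <= 1 -> `|sign_step u| <= 1.
Proof.
rewrite !ler_norml => /andP[u1 u2].
have p : 0 <= (1 - u) ^+ 2 * (2 + u) by rewrite mulr_ge0 ?sqr_ge0//; lra.
have q : 0 <= (1 + u) ^+ 2 * (2 - u) by rewrite mulr_ge0 ?sqr_ge0//; lra.
by rewrite /sign_step; apply/andP; split; lra.
Qed.

Lemma iter_sign_step_bound u n : `|u| <= 1 -> `|iter n sign_step u| <= 1.
Proof. by move=> u1; elim: n => //= n; exact: sign_step_bound. Qed.

Lemma iter_sign_stepN u n : iter n sign_step (- u) = - iter n sign_step u.
Proof. by elim: n => //= n ->; rewrite /sign_step; field. Qed.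

(** The iterates increase, since [sign_step v - v = v (1 - v) (1 + v) / 2], and
    their limit is a fixed point in ]0, 1]. *)
Let cvg_pos (u : R) : 0 < u <= 1 -> iter n sign_step u @[n --> \oo] --> (1 : R).
Proof.
move=> /andP[u0 u1].
have bnd n : u <= iter n sign_step u <= 1.
  elim: n => [|n /= /andP[]]; first by rewrite lexx.
  set v := iter _ _ _ => uv v1.
  have p : 0 <= (1 - v) ^+ 2 * (2 + v) by rewrite mulr_ge0 ?sqr_ge0//; lra.
  have q : 0 <= v * ((1 - v) * (1 + v)) by rewrite !mulr_ge0//; lra.
  by rewrite /sign_step; apply/andP; split; lra.
have nd : nondecreasing_seq (fun n => iter n sign_step u).
  apply/nondecreasing_seqP => n /=; have /andP[] := bnd n.
  set v := iter _ _ _ => uv v1.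
  have q : 0 <= v * ((1 - v) * (1 + v)) by rewrite !mulr_ge0//; lra.
  by rewrite /sign_step; lra.
have cv : cvgn (fun n => iter n sign_step u).
  apply: nondecreasing_is_cvgn => //; exists 1 => _ [n _ <-].
  by have /andP[] := bnd n.
set l := limn _ in cv.
have lfix : sign_step l = l.
  have cv1 : iter n.+1 sign_step u @[n --> \oo] --> l by rewrite -cvg_shiftS in cv.
  apply: (cvg_unique _ _ cv1) => //=.
  rewrite /sign_step; apply: cvgM; last exact: cvg_cst.
  apply: cvgM => //; apply: cvgB; first exact: cvg_cst.
  by rewrite expr2; under eq_fun do rewrite expr2; apply: cvgM.
have ul : u <= l.
  apply: limr_ge; first exact: cvgP cv.
  by apply: nearW => n; have /andP[] := bnd n.
have l1 : l <= 1.
  apply: limr_le; first exact: cvgP cv.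
  by apply: nearW => n; have /andP[] := bnd n.
suff -> : 1 = l by [].
have l0 : 0 < l by exact: lt_le_trans ul.
move: lfix; rewrite /sign_step => e.
have /eqP : l * ((1 - l) * (1 + l)) = 0 by lra.
rewrite !mulf_eq0 gt_eqF//= => /orP[|]; lra.
Qed.

Lemma cvg_iter_sign_step (u : R) : `|u| <= 1 ->
  iter n sign_step u @[n --> \oo] --> Num.sg u.
Proof.
rewrite ler_norml => /andP[u1 u2]; have [u0|u0|->] := ltgtP u 0.
- rewrite ltr0_sg// -[u]opprK; under eq_fun do rewrite iter_sign_stepN.
  apply: cvgN; apply: cvg_pos; lra.
- by rewrite gtr0_sg//; apply: cvg_pos; rewrite u0.
- rewrite sgr0 (_ : (fun _ => _) = cst 0); first exact: cvg_cst.
  by apply/funext; elim=> //= n ->; rewrite /sign_step !mul0r.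
Qed.

Lemma sg_sin (x : R) : `|x| < 1 -> Num.sg (sin x) = Num.sg x.
Proof.
have pi1 : 1 < pi :> R by have := @pi_ge2 R; lra.
rewrite ltr_norml => /andP[x1 x2].
have [x0|x0|->] := ltgtP x 0; last by rewrite sin0.
- have s0 : 0 < sin (- x) by apply: sin_gt0_pi; apply/andP; split; lra.
  by rewrite !ltr0_sg// -oppr_gt0 -sinN.
- by rewrite !gtr0_sg//; apply: sin_gt0_pi; apply/andP; split; lra.
Qed.

End sign.

(** * Uniqueness of measures with the same Fourier transform *)

Section fourier_uniqueness.
Context d (T : measurableType d) (R : realType) (P Q : probability T R).
Variable H : set (T -> R).
Hypothesis mH : forall f, H f -> measurable_fun setT f.
Hypothesis H0 : H (cst 0).
Hypothesis HD : forall f g, H f -> H g -> H (fun x => f x + g x).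
Hypothesis HZ : forall c f, H f -> H (fun x => c * f x).
Hypothesis eq_cos : forall f, H f ->
  \int[P]_x cos (f x) = \int[Q]_x cos (f x).
Hypothesis eq_sin : forall f, H f ->
  \int[P]_x sin (f x) = \int[Q]_x sin (f x).

(** Agreement is required against all the cosines and sines, and not only of the
    integrals of [F]: this is what product-to-sum formulas preserve when [F] is
    multiplied by [cos f] or [sin f]. *)
Definition trig_agree (F : T -> R) := bounded_measurable F /\
  forall f, H f ->
    \int[P]_x (F x * cos (f x)) = \int[Q]_x (F x * cos (f x)) /\
    \int[P]_x (F x * sin (f x)) = \int[Q]_x (F x * sin (f x)).

(** Unlike [trig_agree], this property is visibly stable under products. *)
Definition agree_multiplier (g : T -> R) := bounded_measurable g /\
  forall F, trig_agree F -> trig_agree (fun x => g x * F x).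

Lemma trig_agree1 : trig_agree (cst 1).
Proof.
split; first exact: bounded_measurable_cst.
move=> f Hf; under eq_Rintegral do rewrite mul1r.
under [in X in _ /\ X]eq_Rintegral do rewrite mul1r.
split; under [RHS]eq_Rintegral do rewrite mul1r; [exact: eq_cos|exact: eq_sin].
Qed.

Lemma trig_agree_lin a b F G : trig_agree F -> trig_agree G ->
  trig_agree (fun x => a * F x + b * G x).
Proof.
move=> [bF eF] [bG eG]; split.
  by apply: bounded_measurableD; apply: bounded_measurableM => //;
    exact: bounded_measurable_cst.
move=> f Hf; have [Fc Fs] := eF _ Hf; have [Gc Gs] := eG _ Hf.
have bc := bounded_measurable_cos (mH Hf).
have bs := bounded_measurable_sin (mH Hf).
have lin (m : probability T R) K : bounded_measurable K ->
    \int[m]_x ((a * F x + b * G x) * K x) =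
    a * \int[m]_x (F x * K x) + b * \int[m]_x (G x * K x).
  move=> bK; rewrite -Rintegral_lin; [|exact: bounded_measurableM..].
  by apply: eq_Rintegral => x _; ring.
by split; rewrite !lin// ?Fc ?Gc ?Fs ?Gs.
Qed.

Lemma trig_agree_cvg (F_ : nat -> T -> R) F C : (forall n, trig_agree (F_ n)) ->
  (forall n x, `|F_ n x| <= C) -> (forall x, F_ ^~ x @ \oo --> F x) ->
  trig_agree F.
Proof.
move=> aF F_C F_F; have mF : measurable_fun setT F.
  by apply: (measurable_fun_cvg (h := F_)) => [n|x _]; [case: (aF n) => -[]|exact: F_F].
have FC x : `|F x| <= C.
  have cv : `|F_ n x| @[n --> \oo] --> `|F x| by apply: cvg_norm; exact: F_F.
  rewrite -(cvg_lim _ cv)//; apply: limr_le; first exact: cvgP cv.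
  exact: nearW.
have lim (m : probability T R) (K : T -> R) : measurable_fun setT K ->
    (forall x, `|K x| <= 1) ->
    \int[m]_x (F_ n x * K x) @[n --> \oo] --> \int[m]_x (F x * K x).
  move=> mK K1; apply: (bounded_Rintegral_cvg (C := C)).
  - by move=> n; apply: measurable_funM => //; case: (aF n) => -[].
  - move=> n x; rewrite normrM (le_trans (ler_pM _ _ (F_C n x) (K1 x)))//.
    by rewrite mulr1.
  - by move=> x; apply: cvgM; [exact: F_F|exact: cvg_cst].
split; first by split => //; exists C.
move=> f Hf; have [mc _] := bounded_measurable_cos (mH Hf).
have [ms _] := bounded_measurable_sin (mH Hf); split.
- apply: (cvg_unique _ (lim P _ mc (fun x => cos_max _))) => //.
  have -> : (fun n => \int[P]_x (F_ n x * cos (f x))) =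
            (fun n => \int[Q]_x (F_ n x * cos (f x))).
    by apply/funext => n; case: (aF n) => _ /(_ _ Hf)[].
  exact: lim mc (fun x => cos_max _).
- apply: (cvg_unique _ (lim P _ ms (fun x => sin_abs_le1 _))) => //.
  have -> : (fun n => \int[P]_x (F_ n x * sin (f x))) =
            (fun n => \int[Q]_x (F_ n x * sin (f x))).
    by apply/funext => n; case: (aF n) => _ /(_ _ Hf)[].
  exact: lim ms (fun x => sin_abs_le1 _).
Qed.

Lemma agree_multiplier_cst c : agree_multiplier (cst c).
Proof.
split; first exact: bounded_measurable_cst.
move=> F aF; rewrite (_ : (fun _ => _) = (fun x => c * F x + 0 * F x)).
  exact: trig_agree_lin.
by apply/funext => x; rewrite mul0r addr0.
Qed.

Lemma agree_multiplierD g h : agree_multiplier g -> agree_multiplier h ->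
  agree_multiplier (fun x => g x + h x).
Proof.
move=> [bg ag] [bh ah]; split; first exact: bounded_measurableD.
move=> F aF.
rewrite (_ : (fun _ => _) = (fun x => 1 * (g x * F x) + 1 * (h x * F x))).
  by apply: trig_agree_lin; [exact: ag|exact: ah].
by apply/funext => x; ring.
Qed.

Lemma agree_multiplierM g h : agree_multiplier g -> agree_multiplier h ->
  agree_multiplier (fun x => g x * h x).
Proof.
move=> [bg ag] [bh ah]; split; first exact: bounded_measurableM.
move=> F aF; rewrite (_ : (fun _ => _) = (fun x => g x * (h x * F x))).
  exact/ag/ah.
by apply/funext => x; ring.
Qed.

Lemma agree_multiplier_cvg (g_ : nat -> T -> R) g C :
  (forall n, agree_multiplier (g_ n)) ->
  (forall n x, `|g_ n x| <= C) -> (forall x, g_ ^~ x @ \oo --> g x) ->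
  agree_multiplier g.
Proof.
move=> ag g_C g_g; split.
  have mul1 n : trig_agree (g_ n).
    rewrite (_ : g_ n = (fun x => g_ n x * cst 1 x)); last first.
      by apply/funext => x; rewrite /= mulr1.
    exact: (ag n).2 trig_agree1.
  by have [] := trig_agree_cvg mul1 g_C g_g.
move=> F aF; have [_ [D FD]] := aF.1.
apply: (trig_agree_cvg (F_ := fun n x => g_ n x * F x) (C := C * D)).
- by move=> n; exact: (ag n).2.
- by move=> n x; rewrite normrM ler_pM.
- by move=> x; apply: cvgM; [exact: g_g|exact: cvg_cst].
Qed.

Lemma agree_multiplier_cos_sin f : H f ->
  agree_multiplier (fun x => cos (f x)) /\ agree_multiplier (fun x => sin (f x)).
Proof.
move=> Hf; have bc := bounded_measurable_cos (mH Hf).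
have bs := bounded_measurable_sin (mH Hf).
have product F G A B K a b : bounded_measurable F ->
    bounded_measurable A -> bounded_measurable B ->
    (forall x, G x * K x = a * A x + b * B x) ->
    \int[P]_x (F x * A x) = \int[Q]_x (F x * A x) ->
    \int[P]_x (F x * B x) = \int[Q]_x (F x * B x) ->
    \int[P]_x (G x * F x * K x) = \int[Q]_x (G x * F x * K x).
  move=> bF bA bB e eA eB.
  have E (m : probability T R) : \int[m]_x (G x * F x * K x) =
      a * \int[m]_x (F x * A x) + b * \int[m]_x (F x * B x).
    rewrite -Rintegral_lin; [|exact: bounded_measurableM..].
    apply: eq_Rintegral => x _.
    by rewrite mulrAC e; ring.
  by rewrite !E eA eB.
suff prod F : trig_agree F -> trig_agree (fun x => cos (f x) * F x) /\
    trig_agree (fun x => sin (f x) * F x).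
  by split; split => // F /prod[].
move=> [bF aF].
have hyps g : H g -> exists p m, [/\ H p, H m, (forall x, p x = f x + g x) &
    (forall x, m x = f x - g x)].
  move=> Hg; exists (fun x => f x + g x), (fun x => f x + -1 * g x); split => //.
  - exact: HD.
  - exact: HD Hf (HZ (-1) Hg).
  - by move=> x; rewrite mulN1r.
split; split; try exact: bounded_measurableM.
- move=> g /hyps[p [m [Hp Hm pE mE]]].
  have [pc ps] := aF _ Hp; have [mc ms] := aF _ Hm; split.
  + apply: (product _ _ _ _ _ 2^-1 2^-1 bF _ _ _ pc mc).
    * exact/bounded_measurable_cos/mH.
    * exact/bounded_measurable_cos/mH.
    * by move=> x; rewrite pE mE cosB cosD; field.
  + apply: (product _ _ _ _ _ 2^-1 (- 2^-1) bF _ _ _ ps ms).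
    * exact/bounded_measurable_sin/mH.
    * exact/bounded_measurable_sin/mH.
    * by move=> x; rewrite pE mE sinB sinD; field.
- move=> g /hyps[p [m [Hp Hm pE mE]]].
  have [pc ps] := aF _ Hp; have [mc ms] := aF _ Hm; split.
  + apply: (product _ _ _ _ _ 2^-1 2^-1 bF _ _ _ ps ms).
    * exact/bounded_measurable_sin/mH.
    * exact/bounded_measurable_sin/mH.
    * by move=> x; rewrite pE mE sinB sinD; field.
  + apply: (product _ _ _ _ _ (- 2^-1) 2^-1 bF _ _ _ pc mc).
    * exact/bounded_measurable_cos/mH.
    * exact/bounded_measurable_cos/mH.
    * by move=> x; rewrite pE mE cosB cosD; field.
Qed.

Lemma agree_multiplier_sg g : agree_multiplier g -> (forall x, `|g x| <= 1) ->
  agree_multiplier (fun x => Num.sg (g x)).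
Proof.
move=> ag g1.
apply: (agree_multiplier_cvg (g_ := fun n x => iter n sign_step (g x)) (C := 1)).
- elim=> [|n ih] //=.
  rewrite (_ : (fun _ => _) = (fun x => (iter n sign_step (g x) *
     (cst 3 x + cst (-1) x * (iter n sign_step (g x) * iter n sign_step (g x)))) *
     cst 2^-1 x)); last first.
    by apply/funext => x /=; rewrite /sign_step expr2 mulN1r.
  apply: agree_multiplierM; last exact: agree_multiplier_cst.
  apply: agree_multiplierM => //; apply: agree_multiplierD.
    exact: agree_multiplier_cst.
  apply: agree_multiplierM; first exact: agree_multiplier_cst.
  exact: agree_multiplierM.
- by move=> n x; exact: iter_sign_step_bound.
- by move=> x; exact: cvg_iter_sign_step.
Qed.

(** The sign of [sin] is that of its argument near 0, so the sign of
    [sin ((f x - a) / n)] is that of [f x - a] for [n] large. *)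
Lemma agree_multiplier_sg_sub f a : H f ->
  agree_multiplier (fun x => Num.sg (f x - a)).
Proof.
move=> Hf.
apply: (agree_multiplier_cvg (C := 1)
  (g_ := fun n x => Num.sg (sin (n.+1%:R^-1 * (f x - a))))).
- move=> n; apply: agree_multiplier_sg; last by move=> x; exact: sin_abs_le1.
  have [ac as_] := agree_multiplier_cos_sin (HZ n.+1%:R^-1 Hf).
  rewrite (_ : (fun _ => _) = (fun x =>
    sin (n.+1%:R^-1 * f x) * cst (cos (n.+1%:R^-1 * a)) x +
    cst (- sin (n.+1%:R^-1 * a)) x * cos (n.+1%:R^-1 * f x))); last first.
    by apply/funext => x; rewrite /= mulrBr sinB; ring.
  by apply: agree_multiplierD; apply: agree_multiplierM => //;
    exact: agree_multiplier_cst.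
- by move=> n x; rewrite normr_sg; case: (_ != _); rewrite ?normr0 ?normr1.
- move=> x; apply: cvg_near_cst.
  have : n.+1%:R^-1 * `|f x - a| @[n --> \oo] --> 0 * `|f x - a|.
    by apply: cvgM; [exact: cvg_harmonic|exact: cvg_cst].
  rewrite mul0r => /cvgr0_norm_lt /(_ 1 ltr01); apply: filterS => n nlt1.
  rewrite sg_sin; first by rewrite sgrM gtr0_sg ?mul1r// invr_gt0.
  by move: nlt1; rewrite normrM normr_id -normrM.
Qed.

Definition agree_sets : set (set T) := [set A | agree_multiplier (\1_A : T -> R)].

(** The indicator of the positive reals is [(sg + sg ^+ 2) / 2]. *)
Lemma agree_sets_gt f a : H f -> agree_sets [set x | a < f x].
Proof.
move=> Hf; have as_ := agree_multiplier_sg_sub a Hf.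
rewrite /agree_sets /= (_ : \1__ = (fun x => cst 2^-1 x *
  (Num.sg (f x - a) + Num.sg (f x - a) * Num.sg (f x - a)))).
  apply: agree_multiplierM; first exact: agree_multiplier_cst.
  by apply: agree_multiplierD => //; exact: agree_multiplierM.
apply/funext => x; rewrite indicE /=.
have [ax|xa|->] := ltgtP a (f x).
- by rewrite mem_set// gtr0_sg ?subr_gt0//=; field.
- by rewrite memNset ?ltr0_sg ?subr_lt0//=; [field|apply/negP; rewrite -leNgt ltW].
- by rewrite memNset /= ?subrr ?sgr0 ?ltxx//=; ring.
Qed.

(** Countable unions: the complement of a finite union has as indicator the product
    of those of the complements, and these products converge boundedly. *)
Lemma agree_sets_sigma_algebra : sigma_algebra setT agree_sets.
Proof.
split.
- by rewrite /agree_sets /= indic0; exact: agree_multiplier_cst.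
- move=> A aA; rewrite /agree_sets /=.
  rewrite (_ : \1__ = (fun x => cst 1 x + cst (-1) x * \1_A x)).
    apply: agree_multiplierD; first exact: agree_multiplier_cst.
    by apply: agree_multiplierM => //; exact: agree_multiplier_cst.
  apply/funext => x; rewrite setTD !indicE in_setC /=.
  by case: (x \in A) => /=; ring.
- move=> A aA; rewrite /agree_sets /=.
  have aC n : agree_multiplier (fun x => \prod_(i < n) (1 - \1_(A i) x)).
    elim: n => [|n ih].
      under eq_fun do rewrite big_ord0; exact: agree_multiplier_cst.
    under eq_fun do rewrite big_ord_recr/=; apply: agree_multiplierM => //.
    rewrite (_ : (fun _ => _) = (fun x => cst 1 x + cst (-1) x * \1_(A n) x)).
      apply: agree_multiplierD; first exact: agree_multiplier_cst.
      by apply: agree_multiplierM; [exact: agree_multiplier_cst|exact: aA].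
    by apply/funext => x /=; ring.
  apply: (agree_multiplier_cvg (C := 1)
    (g_ := fun n x => 1 - \prod_(i < n) (1 - \1_(A i) x))).
  + move=> n; rewrite (_ : (fun _ => _) =
      (fun x => cst 1 x + cst (-1) x * \prod_(i < n) (1 - \1_(A i) x))).
      apply: agree_multiplierD; first exact: agree_multiplier_cst.
      by apply: agree_multiplierM => //; exact: agree_multiplier_cst.
    by apply/funext => x /=; ring.
  + move=> n x.
    pose p : R := \prod_(i < n) (1 - \1_(A i) x).
    have p0 : 0 <= p.
      by apply: prodr_ge0 => i _; rewrite indicE; case: (_ \in _); rewrite ?subrr ?subr0.
    have p1 : p <= 1.
      apply: prodr_ile1 => i _; rewrite indicE.
      by case: (_ \in _); rewrite ?subrr ?subr0 ?lexx ?ler01.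
    by rewrite -/p ler_norml; apply/andP; split; lra.
  + move=> x; apply: cvg_near_cst; rewrite indicE.
    have [[i _ Aix]|nA] := pselect ((\bigcup_k A k) x).
      rewrite mem_set; last by exists i.
      exists i.+1 => // n /= ilen.
      rewrite (bigD1 (Ordinal ilen))//= indicE mem_set//= subrr mul0r subr0//.
    rewrite memNset//; apply: nearW => n; rewrite big1 ?subrr// => i _.
    by rewrite indicE memNset ?subr0// => Aix; apply: nA; exists i.
Qed.

Theorem fourier_unique (G : set (set T)) :
  (forall A, G A -> agree_sets A) ->
  forall A, <<s G >> A -> P A = Q A.
Proof.
move=> Ga A sA.
have aA : agree_sets A.
  by move: sA => /(_ agree_sets); apply; split => //; exact: agree_sets_sigma_algebra.
have mA : measurable A.
  by apply/(measurable_indicP R); case: aA => -[].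
have [_ /(_ _ H0)[+ _]] := aA.2 _ trig_agree1.
have E (m : probability T R) : \int[m]_x (\1_A x * cst 1 x * cos (cst 0 x)) = fine (m A).
  under eq_Rintegral do rewrite /= cos0 !mulr1.
  by rewrite /Rintegral integral_indic// setIT.
rewrite !E => e.
by rewrite -[LHS]fineK ?fin_num_measure// -[RHS]fineK ?fin_num_measure// e.
Qed.

End fourier_uniqueness.

(** * Riesz representation and adjoints *)

Section hilbert_space.
Context {R : realType} {X : completeNormedModType R} (ip : {dot X for idfun}).
Hypothesis hip : inner_product_of_norm ip.

Lemma ipC x y : ip x y = ip y x.
Proof. by rewrite hermC/= expr0 mul1r. Qed.

Lemma ipDl x y z : ip (x + y) z = ip x z + ip y z.
Proof. exact: linearDl. Qed.

Lemma ipZl k x y : ip (k *: x) y = k * ip x y.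
Proof. by rewrite linearZl_LR. Qed.

Lemma ipDr x y z : ip x (y + z) = ip x y + ip x z.
Proof. exact: linearDr. Qed.

Lemma ipZr k x y : ip x (k *: y) = k * ip x y.
Proof. by rewrite ipC ipZl ipC. Qed.

Lemma ipNl x y : ip (- x) y = - ip x y.
Proof. exact: linearNl. Qed.

Lemma ipNr x y : ip x (- y) = - ip x y.
Proof. exact: linearNr. Qed.

Lemma ip0l x : ip 0 x = 0.
Proof. exact: linear0l. Qed.

Lemma ip0r x : ip x 0 = 0.
Proof. exact: linear0r. Qed.

Definition ipE := (ipDl, ipDr, ipNl, ipNr, ipZl, ipZr).

Lemma ip_ge0 x : 0 <= ip x x.
Proof. by rewrite hip sqr_ge0. Qed.

Lemma ip_norm_le x y : `|ip x y| <= `|x| * `|y|.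
Proof.
have [->|y0] := eqVneq y 0; first by rewrite ip0r normr0 mulr_ge0.
rewrite -ler_sqr ?nnegrE ?mulr_ge0// real_normK ?num_real// exprMn -!hip.
have yy : 0 < ip y y by rewrite hip exprn_gt0// normr_gt0.
have := ip_ge0 (ip y y *: x - ip x y *: y).
rewrite !ipE (ipC y x) => h.
rewrite -(ler_pM2l yy) -subr_ge0; apply: le_trans h _.
by rewrite le_eqVlt; apply/orP; left; apply/eqP; ring.
Qed.

Lemma ip_continuous y : continuous (fun x => ip x y).
Proof.
move=> x; apply/cvgrPdist_le => e e0; near=> z.
rewrite -ipNl -ipDl (le_trans (ip_norm_le _ _))//.
rewrite (le_trans (y := `|x - z| * (`|y| + 1)))//.
  by rewrite ler_wpM2l// lerDl.
rewrite -ler_pdivlMr; last by rewrite ltr_wpDl.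
near: z; apply: cvgr_dist_le; first exact: cvg_id.
by rewrite divr_gt0// ltr_wpDl.
Unshelve. all: by end_near. Qed.

(** Minimize [J x = <x, x> - 2 f x], which is bounded below.  The parallelogram
    identity makes every minimizing sequence Cauchy, and the first variation of [J]
    at its limit [v] says that [<v, h> = f h]. *)
Theorem riesz_representation (f : X -> R) (C : R) :
  (forall k x y, f (k *: x + y) = k * f x + f y) ->
  (forall x, `|f x| <= C * `|x|) ->
  exists v, forall x, f x = ip v x.
Proof.
move=> flin fC.
have fD x y : f (x + y) = f x + f y by rewrite -{1}[x]scale1r flin mul1r.
have f0 : f 0 = 0.
  apply: (@addrI _ (f 0)).
  by rewrite -fD !addr0.
have fZ k x : f (k *: x) = k * f x by rewrite -{1}[k *: x]addr0 flin f0 addr0.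
pose J x := ip x x - 2 * f x.
have Jlb x : - C ^+ 2 <= J x.
  rewrite /J hip; have := fC x; rewrite ler_norml => /andP[_ h].
  by have := sqr_ge0 (`|x| - C); lra.
have hinf : has_inf (range J).
  by split; [exists (J 0), 0|exists (- C ^+ 2) => _ [x _ <-]].
pose m := inf (range J).
have mJ x : m <= J x by apply: ge_inf; [case: hinf|exists x].
have ex n : exists x, J x < m + n.+1%:R^-1.
  have [|_ [x _ <-] h] := @inf_adherent _ (range J) n.+1%:R^-1 _ hinf.
    by rewrite invr_gt0.
  by exists x.
have [u uP] := choice ex.
have par x y : ip (x - y) (x - y) <= 2 * (J x - m + (J y - m)).
  have := mJ (2^-1 *: (x + y)); rewrite /J fZ fD !ipE (ipC y x) => h; lra.
have cu : cvgn u.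
  apply/cauchy_cvgP/cauchy_exP => e e0.
  have h0 : n.+1%:R^-1 * (4 : R) @[n --> \oo] --> (0 * 4 : R).
    by apply: cvgM; [exact: cvg_harmonic|exact: cvg_cst].
  rewrite mul0r in h0.
  have /cvgr0_norm_lt/(_ _ (exprn_gt0 2 e0))[N _ HN] := h0.
  exists (u N); exists N => //= n /= Nn; rewrite -ball_normE /=.
  rewrite -ltr_sqr ?nnegrE ?(ltW e0)// -hip.
  apply: le_lt_trans (par _ _) _; apply: le_lt_trans (HN N (leqnn N)).
  rewrite ger0_norm ?mulr_ge0 ?invr_ge0//.
  have h1 := uP N; have h2 := uP n.
  have h3 : n.+1%:R^-1 <= N.+1%:R^-1 :> R by rewrite lef_pV2 ?posrE// ler_nat.
  move: h1 h2 h3; move: (J (u N)) (J (u n)) (N.+1%:R^-1) (n.+1%:R^-1) => *; lra.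
set v := limn u in cu.
exists v => h; apply/eqP; rewrite -subr_eq0.
have var s : 0 <= 2 * s * (ip v h - f h) + s ^+ 2 * ip h h.
  have cv : n.+1%:R^-1 + (2 * s * (ip (u n) h - f h) + s ^+ 2 * ip h h)
      @[n --> \oo] --> 0 + (2 * s * (ip v h - f h) + s ^+ 2 * ip h h).
    apply: cvgD; first exact: cvg_harmonic.
    apply: cvgD; last exact: cvg_cst.
    apply: cvgM; first exact: cvg_cst.
    apply: cvgB; last exact: cvg_cst.
    exact: (cvg_comp _ _ cu (@ip_continuous h v)).
  rewrite add0r in cv; rewrite -(cvg_lim _ cv)//.
  apply: limr_ge; first exact: cvgP cv.
  apply: nearW => n; have := mJ (u n + s *: h); have := uP n.
  rewrite /J fD fZ !ipE (ipC h (u n)).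
  by move: (n.+1%:R^-1) => a; lra.
set d := ip v h - f h in var.
(* The value of [s] that nearly minimizes the quadratic; the summand 1 avoids a
   case analysis on [h = 0]. *)
have d0 : d ^+ 2 <= 0.
  have hh := ip_ge0 h.
  have := var (- d / (1 + ip h h)).
  have p : 0 < 1 + ip h h by lra.
  have -> : 2 * (- d / (1 + ip h h)) * d + (- d / (1 + ip h h)) ^+ 2 * ip h h =
    - (d ^+ 2 * (2 + ip h h) / (1 + ip h h) ^+ 2).
    by field; rewrite gt_eqF.
  rewrite oppr_ge0 pmulr_lle0 ?invr_gt0 ?exprn_gt0// pmulr_lle0//; lra.
have : d ^+ 2 == 0 by rewrite eq_le d0 sqr_ge0.
by rewrite sqrf_eq0 /d !subr_eq0 eq_sym.
Qed.

(** Continuity makes the set under the supremum in [opnorm] bounded above, so that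
    [sup] is a genuine least upper bound. *)
Lemma opnorm_le (T : {linear X -> X}) x :
  continuous T -> `|T x| <= opnorm T * `|x|.
Proof.
move=> cT; have [->|x0] := eqVneq x 0; first by rewrite linear0 !normr0 mulr0.
have /linear_bounded_continuous/linear_boundedP bT := cT.
have [M [Mreal HM]] := bT.
have bM y : `|T y| <= (M + 1) * `|y| by apply: HM; rewrite ltrDl.
have nx : 0 < `|x| by rewrite normr_gt0.
rewrite -ler_pdivrMr//; apply: ub_le_sup.
  exists (`|M + 1|) => _ [y /= y1 <-]; apply: le_trans (bM y) _.
  apply: le_trans (ler_norm _) _; rewrite normrM normr_id.
  by rewrite ler_piMr.
exists (`|x|^-1 *: x) => /=.
  by rewrite normrZ normfV normr_id mulVf// gt_eqF.
by rewrite linearZ normrZ normfV normr_id mulrC.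
Qed.

Lemma adjointP (T : {linear X -> X}) x y :
  continuous T -> ip (T x) y = ip x (adjoint ip T y).
Proof.
move=> cT.
have ex z : exists v, forall w, ip (T w) z = ip w v.
  have [||v vP] := @riesz_representation (fun w => ip (T w) z) (opnorm T * `|z|).
  - by move=> k a b; rewrite linearP ipDl ipZl.
  - move=> w; rewrite (le_trans (ip_norm_le _ _))// mulrAC ler_wpM2r//.
    exact: opnorm_le.
  - by exists v => w; rewrite vP ipC.
have [S SP] := choice ex.
have exS : exists S, forall x y, ip (T x) y = ip x (S y) by exists S => a b; exact: SP.
exact: (xgetPex (cst 0) exS).
Qed.

Lemma adjoint_norm_le (T : {linear X -> X}) y :
  continuous T -> `|adjoint ip T y| <= opnorm T * `|y|.
Proof.
move=> cT; set z := adjoint ip T y.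
have [->|z0] := eqVneq z 0.
  have := opnorm_le y cT; rewrite normr0; exact: le_trans.
have nz : 0 < `|z| by rewrite normr_gt0.
rewrite -(ler_pM2l nz) -expr2 -hip -adjointP//.
apply: le_trans (ler_norm _) _; apply: le_trans (ip_norm_le _ _) _.
by rewrite mulrA ler_wpM2r// mulrC opnorm_le.
Qed.

End hilbert_space.

(** * Weak measurability in a separable Hilbert space *)

Section weak_measurability.
Context {R : realType} {X : completeNormedModType R} (ip : {dot X for idfun}).
Hypothesis hip : inner_product_of_norm ip.
Hypothesis hsep : @separable R X.

Lemma dense_seq :
  exists d : nat -> X, forall x (e : R), 0 < e -> exists n, `|x - d n| < e.
Proof.
have [D /countable_injP[f finj] dD] := hsep.
exists (fun n => xget 0 [set x | D x /\ f x = n]) => x e e0.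
have [|y [xy Dy]] := dD (ball x e) _ (ball_open x e).
  by exists x; exact: ballxx.
exists (f y); rewrite -ball_normE /= in xy.
rewrite (_ : xget _ _ = y)//; apply: xget_unique => // z [Dz fz].
by apply: finj => //; rewrite inE.
Qed.

(** This holds because [2 <v, d> - <d, d> = <v, v> - |v - d|^2]: the squared norm is
    the supremum, over a dense sequence, of functions that are affine in [v], hence
    measurable as soon as [v] depends on a parameter in a weakly measurable way. *)
Lemma sqnorm_gtP (d : nat -> X) v c :
  (forall x (e : R), 0 < e -> exists n, `|x - d n| < e) ->
  c < ip v v <-> exists n, c < 2 * ip v (d n) - ip (d n) (d n).
Proof.
have E n : 2 * ip v (d n) - ip (d n) (d n) = ip v v - `|v - d n| ^+ 2.
  by rewrite -hip !ipE (ipC ip (d n) v); ring.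
move=> dd; split=> [cv|[n]]; last first.
  by rewrite E; have := sqr_ge0 `|v - d n|; lra.
have [|n vn] := dd v (Num.min 1 (ip v v - c)).
  by rewrite lt_min ltr01 subr_gt0.
exists n; rewrite E.
move: vn; rewrite lt_min => /andP[v1 vc].
have := normr_ge0 (v - d n) => v0.
have : `|v - d n| ^+ 2 <= `|v - d n| by rewrite expr2 ler_piMl// ltW.
lra.
Qed.

Definition weakly_measurable d (S : measurableType d) (D : set S) (a : S -> X) :=
  forall y, measurable_fun D (fun r => ip (a r) y).

Lemma weakly_measurable_sqnorm d (S : measurableType d) (D : set S) (a : S -> X) :
  weakly_measurable D a -> measurable_fun D (fun r => ip (a r) (a r)).
Proof.
move=> wa mD; move: (mD).
apply: (measurability _ (RGenOInfty.measurableE R)).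
move=> _ [_ [c ->] <-].
have [u du] := dense_seq.
rewrite (_ : _ `&` _ = \bigcup_n (D `&`
    (fun r => 2 * ip (a r) (u n) - ip (u n) (u n)) @^-1` `]c, +oo[)).
  apply: bigcupT_measurable => n.
  have /(_ mD `]c, +oo[%classic) := measurable_funB
    (measurable_funM (measurable_cst (2 : R)) (wa (u n)))
    (measurable_cst (ip (u n) (u n))).
  by apply; exact: measurable_itv.
apply/seteqP; split => [r /= [Dr]|r [n _ /= [Dr]]].
  rewrite in_itv/= andbT => /(sqnorm_gtP _ _ du)[n cn].
  by exists n => //; split => //=; rewrite in_itv/= andbT.
rewrite in_itv/= andbT => cn; split => //; rewrite in_itv/= andbT.
by apply/(sqnorm_gtP _ _ du); exists n.
Qed.

(** By polarization, from the case of squared norms. *)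
Lemma weakly_measurable_ip d (S : measurableType d) (D : set S) (a b : S -> X) :
  weakly_measurable D a -> weakly_measurable D b ->
  measurable_fun D (fun r => ip (a r) (b r)).
Proof.
move=> wa wb; rewrite (_ : (fun _ => _) = (fun r =>
  2^-1 * (ip (a r + b r) (a r + b r) - ip (a r) (a r) - ip (b r) (b r)))).
  apply: measurable_funM => //; apply: measurable_funB; first apply: measurable_funB.
  - apply: weakly_measurable_sqnorm => y.
    by under eq_fun do rewrite ipDl; apply: measurable_funD; [exact: wa|exact: wb].
  - exact: weakly_measurable_sqnorm.
  - exact: weakly_measurable_sqnorm.
by apply/funext => r; rewrite !ipE (ipC ip (b r) (a r)); field.
Qed.

Lemma continuous_borel_measurable (f : X -> R) : continuous f ->
  measurable_fun [set: borel X] (f : borel X -> measurableTypeR R).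
Proof.
move=> cf; apply: (measurability _ (RGenOInfty.measurableE R)).
move=> _ [_ [c ->] <-]; rewrite setTI; apply: sub_sigma_algebra.
by move/continuousP : cf; apply; exact: interval_open.
Qed.

Definition halfspaces : set (set X) :=
  [set A | exists h c, A = [set x | c < ip x h]].

(** For the sigma-algebra generated by half-spaces the identity is weakly
    measurable, so closed balls belong to it; by separability an open set is a
    countable union of closed balls. *)
Lemma borel_halfspaces (A : set (borel X)) :
  measurable A -> <<s halfspaces >> A.
Proof.
apply: smallest_sub; first exact: smallest_sigma_algebra.
move=> O oO; change (@measurable _ (g_sigma_algebraType halfspaces) O).
have wid (z : X) : weakly_measurable [set: g_sigma_algebraType halfspaces]
    (fun x => (x : X) - z).
  move=> h; apply: (measurability _ (RGenOInfty.measurableE R)).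
  move=> _ [_ [c ->] <-]; rewrite setTI; apply: sub_sigma_algebra.
  exists h, (c + ip z h); apply/seteqP; split => x /=;
    by rewrite in_itv/= andbT ipDl ipNl ltrBrDr.
pose B z k : set (g_sigma_algebraType halfspaces) :=
  [set x : X | ip (x - z) (x - z) <= k.+1%:R^-1].
have mB z k : measurable (B z k).
  have := weakly_measurable_sqnorm (wid z) measurableT
    (measurable_itv `]-oo, k.+1%:R^-1]).
  rewrite setTI; set B' := _ @^-1` _ => mB'.
  have -> : B z k = B' by apply/seteqP; split => x; rewrite /B /B' /= in_itv.
  exact: mB'.
have [u du] := dense_seq.
rewrite (_ : O = \bigcup_n \bigcup_(k in [set k | B (u n) k `<=` O]) B (u n) k).
  by apply: bigcupT_measurable => n; apply: bigcup_measurable.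
apply/seteqP; split => [x Ox|x [n _ [k kO]]]; last exact: kO.
have /nbhs_ballP[e /= e0 eO] : nbhs x O by exact: open_nbhs_nbhs.
have e20 : 0 < (e / 2) ^+ 2 by rewrite exprn_gt0// divr_gt0.
have /cvgr0_norm_lt/(_ _ e20)[k _ /(_ k (leqnn k))] := @cvg_harmonic R.
rewrite /= ger0_norm ?invr_ge0// => ke.
have sq0 : 0 < Num.sqrt k.+1%:R^-1 :> R by rewrite sqrtr_gt0 invr_gt0.
have [n xn] := du x _ sq0.
have sqlt : Num.sqrt k.+1%:R^-1 < e / 2.
  by rewrite -ltr_sqr ?nnegrE ?sqrtr_ge0 ?divr_ge0 ?ltW// sqr_sqrtr// invr_ge0.
exists n => //; exists k => /=.
  move=> y /=; rewrite /B /= hip => yn; apply: eO; rewrite -ball_normE /=.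
  have yn' : `|y - u n| <= Num.sqrt k.+1%:R^-1.
    by rewrite -ler_sqr ?nnegrE ?sqrtr_ge0// sqr_sqrtr// invr_ge0.
  have -> : x - y = (x - u n) - (y - u n) by rewrite opprB addrA subrK.
  rewrite (le_lt_trans (ler_normB _ _))//; lra.
rewrite /B /= hip -[leRHS]sqr_sqrtr ?invr_ge0// ler_sqr ?nnegrE ?sqrtr_ge0//.
exact: ltW.
Qed.

End weak_measurability.

(** * Laws on the real line *)

Section laws.
Context {R : realType}.
Notation leb := (@lebesgue_measure R).

Lemma law_exists d (T : measurableType d) (P : probability T R)
    (f : T -> measurableTypeR R) : measurable_fun [set: T] f ->
  exists2 L : probability (measurableTypeR R) R,
    (forall A, L A = pushforward P f A) &
    forall g, bounded_measurable g -> \int[L]_z g z = \int[P]_x g (f x).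
Proof.
move=> mf.
pose fM := isMeasurableFun.Build _ _ _ _ _ mf.
pose f' : {mfun T >-> measurableTypeR R} := HB.pack f fM.
exists (distribution P f') => // g bg.
rewrite /Rintegral.
rewrite (@integral_distribution _ _ T (measurableTypeR R) R P f' (EFin \o g))//.
- by apply/measurable_EFinP; case: bg.
- apply: bounded_measurable_integrable; split.
    by apply: (measurableT_comp (f := g)) => //; case: bg.
  by case: bg => _ [C gC]; exists C => x; exact: gC.
Qed.

Lemma eq_law_Rintegral (L M : probability (measurableTypeR R) R) g :
  (forall A, measurable A -> L A = M A) -> \int[L]_z g z = \int[M]_z g z.
Proof.
by move=> LM; congr fine; apply: eq_measure_integral => A mA _; exact: LM.
Qed.

(** The centered normal law of variance [v] packaged as a probability, so that one
    can integrate against it. *)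
Definition normal_law_probability (v : R) : probability (measurableTypeR R) R :=
  if v == 0 then (@dirac _ (measurableTypeR R) 0 R : probability _ R)
  else (normal_prob 0 (Num.sqrt v) : probability _ R).

Lemma normal_law_probabilityE v A : normal_law 0 v A = normal_law_probability v A.
Proof. by rewrite /normal_law /normal_law_probability; case: ifP. Qed.

Lemma Rintegral_normal_prob (m s : R) g : s != 0 -> bounded_measurable g ->
  \int[normal_prob m s]_x g x = \int[leb]_x (g x * normal_pdf m s x).
Proof.
move=> s0 bg; congr fine.
have ig : (normal_prob m s).-integrable setT (EFin \o g).
  exact: bounded_measurable_integrable.
rewrite -(Radon_Nikodym_change_of_variables (normal_prob_dominates m s))//=.
have mg : measurable_fun setT (EFin \o g) by exact: measurable_int ig.
under [RHS]eq_integral do rewrite EFinM.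
apply: ae_eq_integral => //.
- apply: emeasurable_funM => //; apply: (measurable_int leb).
  by apply: Radon_Nikodym_integrable; exact: normal_prob_dominates.
- apply: emeasurable_funM => //; apply/measurable_EFinP.
  exact: measurable_normal_pdf.
- apply: ae_eqe_mul2l => /=.
  rewrite Radon_NikodymE//=; first exact: normal_prob_dominates.
  move=> dom; case: cid => /= h [h1 h2 h3].
  apply: integral_ae_eq => //=.
  + by apply/measurable_EFinP; exact: measurable_normal_pdf.
  + by move=> E E01 mE; rewrite -h3.
Qed.

(** Domination of the densities of variance in [q / 4, q] by an integrable function,
    for the dominated convergence in [cvg_normal_law]. *)
Lemma normal_pdf_sqrt_le (q v x : R) : 0 < q -> q / 4 <= v -> v <= q ->
  normal_pdf 0 (Num.sqrt v) x <= 2 * normal_pdf 0 (Num.sqrt q) x.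
Proof.
move=> q0 qv vq; have v0 : 0 < v by apply: lt_le_trans qv; rewrite divr_gt0.
have sv : Num.sqrt v != 0 by rewrite gt_eqF// sqrtr_gt0.
have sq : Num.sqrt q != 0 by rewrite gt_eqF// sqrtr_gt0.
rewrite !normal_pdfE// mulrA ler_pM//.
- exact: normal_peak_ge0.
- exact: normal_fun_ge0.
- rewrite /normal_peak (sqr_sqrtr (ltW v0)) (sqr_sqrtr (ltW q0)).
  have p0 : 0 < pi :> R by exact: pi_gt0.
  have sq0 w : 0 < w -> 0 < Num.sqrt (w * pi *+ 2) :> R.
    by move=> w0; rewrite sqrtr_gt0 mulrn_wgt0// mulr_gt0.
  have -> w : 2 * w^-1 = (2^-1 * w)^-1 :> R by rewrite invfM invrK.
  rewrite lef_pV2 ?posrE ?mulr_gt0 ?sq0//.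
  rewrite -ler_sqr ?nnegrE ?mulr_ge0 ?sqrtr_ge0 ?invr_ge0//.
  have pi2 w : 0 < w -> 0 <= w * pi *+ 2 :> R.
    by move=> w0; rewrite mulrn_wge0// mulr_ge0 ?ltW.
  rewrite exprMn (sqr_sqrtr (pi2 _ v0)) (sqr_sqrtr (pi2 _ q0)).
  rewrite -(ler_pM2r p0) in qv.
  by move: pi p0 qv {sq0 pi2} => p p0 qv; lra.
- rewrite /normal_fun subr0 (sqr_sqrtr (ltW v0)) (sqr_sqrtr (ltW q0)).
  rewrite ler_expR !mulNr lerN2.
  rewrite ler_wpM2l ?sqr_ge0// lef_pV2 ?posrE ?mulrn_wgt0// lerMn2r.
  by rewrite vq orbT.
Qed.

(** When [q] is positive the densities converge; when [q] is 0 all the laws are the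
    Dirac mass at 0, because [q] bounds the variances from above. *)
Lemma cvg_normal_law (q_ : nat -> R) (q : R) g : bounded_measurable g ->
  (forall n, 0 <= q_ n <= q) -> q_ n @[n --> \oo] --> q ->
  \int[normal_law_probability (q_ n)]_z g z @[n --> \oo] -->
  \int[normal_law_probability q]_z g z.
Proof.
move=> bg q_le q_q; have [q0|q0|q0] := ltgtP q 0.
- by have /andP[/le_trans h /h] := q_le 0; rewrite leNgt q0.
- have [N _ HN] : \forall n \near \oo, q / 4 <= q_ n.
    by apply: (cvgr_ge _ q_q); lra.
  rewrite -(cvg_shiftn N).
  have q_0 n : 0 < q_ (n + N)%N.
    by apply: lt_le_trans (HN _ (leq_addl n N)); rewrite divr_gt0.
  have E v : 0 < v -> \int[normal_law_probability v]_z g z =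
      \int[leb]_z (g z * normal_pdf 0 (Num.sqrt v) z).
    move=> v0; rewrite /normal_law_probability gt_eqF//.
    by rewrite Rintegral_normal_prob// gt_eqF// sqrtr_gt0.
  refine (eq_ind _ (fun l : R =>
    \int[normal_law_probability (q_ (n + N)%N)]_z g z @[n --> \oo] --> l)
    _ _ (esym (E q q0))).
  have -> : (fun n => \int[normal_law_probability (q_ (n + N)%N)]_z g z) =
      (fun n => \int[leb]_z (g z * normal_pdf 0 (Num.sqrt (q_ (n + N)%N)) z)).
    by apply/funext => n; exact: E (q_0 n).
  have [mg [C gC]] := bg.
  apply: (@dominated_Rintegral _ _ R leb setT
    (fun n z => g z * normal_pdf 0 (Num.sqrt (q_ (n + N)%N)) z)
    (fun z => g z * normal_pdf 0 (Num.sqrt q) z)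
    (fun z => C * (2 * normal_pdf 0 (Num.sqrt q) z))) => //.
  + by move=> n; apply: measurable_funM => //; exact: measurable_normal_pdf.
  + move=> x _; apply: cvgM; first exact: cvg_cst.
    rewrite normal_pdfE ?gt_eqF ?sqrtr_gt0//.
    under eq_fun do rewrite normal_pdfE ?gt_eqF ?sqrtr_gt0//.
    rewrite /normal_peak /normal_fun sqr_sqrtr ?ltW//.
    under eq_fun do rewrite sqr_sqrtr ?(ltW (q_0 _))//.
    have qN : q_ (n + N)%N @[n --> \oo] --> q by rewrite cvg_shiftn.
    have q2 c : q_ (n + N)%N * c *+ 2 @[n --> \oo] --> q * c *+ 2.
      rewrite -mulr_natr; under eq_fun do rewrite -mulr_natr.
      by apply: cvgM; [apply: cvgM => //; exact: cvg_cst|exact: cvg_cst].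
    apply: cvgM.
      apply: cvgV; first by rewrite gt_eqF ?sqrtr_gt0 ?mulrn_wgt0 ?mulr_gt0 ?pi_gt0.
      exact: (cvg_comp _ _ (q2 _) (@sqrt_continuous R _)).
    suff ex : - (x - 0) ^+ 2 / (q_ (n + N)%N *+ 2) @[n --> \oo] -->
        - (x - 0) ^+ 2 / (q *+ 2).
      exact: (cvg_comp _ _ ex (@continuous_expR R _)).
    apply: cvgM; first exact: cvg_cst.
    apply: cvgV; first by rewrite gt_eqF ?mulrn_wgt0.
    by have := q2 1; rewrite mulr1; under eq_fun do rewrite mulr1.
  + have -> : EFin \o (fun x => C * (2 * normal_pdf 0 (Num.sqrt q) x)) =
      (fun x => (C * 2)%:E * (normal_pdf 0 (Num.sqrt q) x)%:E)%E.
      by apply/funext => x /=; rewrite -EFinM mulrA.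
    apply: integrableZl => //; exact: integrable_normal_pdf.
  + move=> n x _; rewrite normrM ler_pM// ger0_norm ?normal_pdf_ge0//.
    apply: normal_pdf_sqrt_le => //; first exact/HN/leq_addl.
    by have /andP[] := q_le (n + N)%N.
- have -> : q_ = cst q.
    apply/funext => n; apply/eqP; rewrite eq_le.
    by have /andP[h ->] := q_le n; rewrite q0.
  by apply: cvg_near_cst; exact: nearW.
Qed.

End laws.

(** * Covariance operators of the evolution *)

Lemma integrable_expR_Ny (R : realType) (c t : R) : 0 < c ->
  (@lebesgue_measure R).-integrable `]-oo, t]
    (EFin \o (fun r => expR (c * (r - t)))).
Proof.
move=> c0.
pose G r := expR (c * (r - t)).
have cG : continuous G.
  move=> x; apply: continuous_comp; last exact: continuous_expR.
  by apply: cvgM; [exact: cvg_cst|apply: cvgB; [exact: cvg_id|exact: cvg_cst]].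
apply/integrableP; split.
  apply/measurable_EFinP; apply: measurable_funTS; exact: continuous_measurable_fun.
under eq_integral do rewrite /= ger0_norm ?expR_ge0//.
pose F (x : R) : R := - c^-1 * expR (c * (- x - t)).
have dF (x : R) : is_derive x 1 F (G (- x)).
  rewrite /F; apply: is_derive_eq; rewrite /G /GRing.scale /=.
  by field; rewrite gt_eqF.
have := @ge0_integration_by_substitutionNy R G (- t).
rewrite opprK => ->; first last.
- by move=> x _; exact: expR_ge0.
- exact: continuous_subspaceT.
rewrite (@ge0_continuous_FTC2y R (G \o -%R) F (- t) 0) ?ltry//.
- by move=> x _; exact: expR_ge0.
- apply: continuous_subspaceT => x; apply: continuous_comp; last exact: cG.
  by apply: cvgN; exact: cvg_id.
- rewrite -(mulr0 (- c^-1)); apply: cvgM; first exact: cvg_cst.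
  rewrite (_ : (fun x => _) = (fun z => expR (- z)) \o (fun z => c * (z + t))).
    apply: (@cvg_comp _ _ _ _ _ _ (pinfty_nbhs R)); last exact: cvgr_expR.
    apply: gt0_cvgMry => //; exact: cvg_addrr.
  by apply/funext => x /=; rewrite -mulrN opprD.
- by apply/cvg_at_right_filter/differentiable_continuous/derivable1_diffP.
- by move=> x _; rewrite derive1E derive_val.
Qed.

Section covariance.
Context {R : realType} {X : completeNormedModType R} (ip : {dot X for idfun}).
Hypothesis hip : inner_product_of_norm ip.
Hypothesis hsep : @separable R X.
Variable U : R -> R -> {linear X -> X}.
Hypothesis hU : evolution_operator U.
Hypothesis homega0 : (ereal_inf (EFin @` growth_rates U) < 0)%E.
Variable B : R -> {linear X -> X}.
Hypothesis hBcont : forall t, continuous (B t).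
Hypothesis hBbnd : exists C : R, forall t, opnorm (B t) <= C.
Hypothesis hBmeas : forall x, measurable_fun [set: measurableTypeR R]
  (fun t : measurableTypeR R => B t x : borel X).
Notation leb := (@lebesgue_measure R).

Let U_continuous s t : s <= t -> continuous (U t s).
Proof. by case: hU => h _ _ _; exact: h. Qed.

Lemma exponential_stability : exists M c : R, [/\ 0 < M, 0 < c &
  forall s t, s <= t -> opnorm (U t s) <= M * expR (c * (s - t))].
Proof.
have [_ [w [M M0 HM] <-]] := ereal_inf_lt homega0.
rewrite lte_fin => w0; exists M, (- w); split; rewrite ?oppr_gt0// => s t st.
by rewrite mulNr -mulrN opprB; exact: HM.
Qed.

Lemma opnorm_ge0 (T : {linear X -> X}) : continuous T -> 0 <= opnorm T.
Proof.
move=> cT; have [x0|] := pselect (exists x : X, x != 0).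
  have [x x0'] := x0; have := opnorm_le x cT.
  have nx : 0 < `|x| by rewrite normr_gt0.
  by rewrite -ler_pdivrMr//; apply: le_trans; rewrite divr_ge0.
move=> /forallNP nx; rewrite /opnorm.
rewrite (_ : [set _ | _ in _] = [set 0]) ?sup1//.
have x0 (x : X) : x = 0 by apply/eqP/negPn/negP/nx.
apply/seteqP; split => [_ [x _ <-]|_ ->] /=.
  by rewrite (x0 x) linear0 normr0.
by exists 0; rewrite /= ?normr0 ?linear0 ?normr0.
Qed.

(** The path [r |-> U t r x] is continuous on [r <= t] only, hence the restriction to
    this half-line here and below. *)
Lemma weakly_measurable_trajectory t x :
  weakly_measurable ip (`]-oo, t] : set (measurableTypeR R)) (fun r => U t r x).
Proof.
move=> y; apply: subspace_continuous_measurable_fun; first exact: measurable_itv.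
apply/subspace_continuousP => r /=; rewrite in_itv/= => rt.
have [_ _ _ /(_ x)/subspace_continuousP/(_ (t, r) rt) cU] := hU.
suff cUr : U t r' x @[r' --> within `]-oo, t]%classic (nbhs r)] --> U t r x.
  exact: (cvg_comp _ _ cUr (@ip_continuous _ _ _ hip y (U t r x))).
move=> P /cU /= h.
have ct : (t, r') @[r' --> r] --> (t, r).
  exact: (cvg_pair (cvg_cst t) cvg_id).
have h2 : nbhs r (fun r' => r' <= t -> P (U t r' x)) by exact: (ct _ h).
change (nbhs r (fun r' => `]-oo, t]%classic r' -> P (U t r' x))).
by apply: filterS h2 => r' /= hr'; rewrite in_itv/=; exact: hr'.
Qed.

(** [B(r)^* U(t,r)^* x], so that [<U(t,r) B(r) B(r)^* U(t,r)^* x, y>] is the inner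
    product of the paths of [x] and [y]. *)
Definition adjoint_path t x r := adjoint ip (B r) (adjoint ip (U t r) x).

Lemma weakly_measurable_adjoint_path t x :
  weakly_measurable ip (`]-oo, t] : set (measurableTypeR R)) (adjoint_path t x).
Proof.
move=> z; apply: (eq_measurable_fun
    (fun r : measurableTypeR R => ip (adjoint ip (U t r) x) (B r z))).
  move=> r; rewrite inE/= in_itv/= => rt.
  by rewrite (ipC ip (adjoint_path _ _ _)) -(adjointP hip)// ipC.
apply: (weakly_measurable_ip hip hsep) => y.
  apply: (eq_measurable_fun (fun r : measurableTypeR R => ip (U t r y) x)).
    move=> r; rewrite inE/= in_itv/= => rt.
    rewrite (ipC ip (adjoint _ _ _)) -(adjointP hip)//; exact: U_continuous.
  exact: weakly_measurable_trajectory.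
apply: measurable_funTS.
apply: (measurableT_comp (f := fun x : borel X => ip x y)); last exact: hBmeas.
by apply: continuous_borel_measurable; exact: ip_continuous.
Qed.

Lemma ip_cov_integrand t r x y : r <= t ->
  ip (cov_integrand ip U B t r x) y = ip (adjoint_path t x r) (adjoint_path t y r).
Proof.
move=> rt; rewrite /cov_integrand (adjointP hip); last exact: U_continuous.
by rewrite (adjointP hip).
Qed.

Lemma adjoint_path_norm_le : exists K c : R, [/\ 0 <= K, 0 < c &
  forall t x r, r <= t -> `|adjoint_path t x r| <= K * expR (c * (r - t)) * `|x| ].
Proof.
have [M [c [M0 c0 HM]]] := exponential_stability.
have [C HC] := hBbnd.
have C0 : 0 <= C.
  by apply: le_trans (HC 0); apply: opnorm_ge0; exact: hBcont.
exists (C * M), c; split => // [|t x r rt]; first by rewrite mulr_ge0 ?(ltW M0).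
rewrite /adjoint_path.
have h1 := adjoint_norm_le hip (adjoint ip (U t r) x) (@hBcont r).
have h2 := adjoint_norm_le hip x (U_continuous rt).
apply: le_trans h1 _.
rewrite -!mulrA ler_pM//; first exact: opnorm_ge0.
apply: le_trans h2 _.
by rewrite mulrA ler_wpM2r// HM.
Qed.

Lemma cov_integrable t : exists2 g : R -> R,
  leb.-integrable `]-oo, t] (EFin \o g) &
  forall x y r, r <= t ->
    `|ip (adjoint_path t x r) (adjoint_path t y r)| <= g r * (`|x| * `|y|).
Proof.
have [K [c [K0 c0 HK]]] := adjoint_path_norm_le.
exists (fun r => K ^+ 2 * expR ((c *+ 2) * (r - t))).
  have -> : EFin \o (fun r => K ^+ 2 * expR ((c *+ 2) * (r - t))) =
      (fun r => (K ^+ 2)%:E * (expR ((c *+ 2) * (r - t)))%:E)%E.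
    by apply/funext => r /=; rewrite -EFinM.
  apply: integrableZl; first exact: measurable_itv.
  by apply: integrable_expR_Ny; rewrite mulrn_wgt0.
move=> x y r rt; apply: le_trans (ip_norm_le hip _ _) _.
have -> : K ^+ 2 * expR ((c *+ 2) * (r - t)) * (`|x| * `|y|) =
  (K * expR (c * (r - t)) * `|x|) * (K * expR (c * (r - t)) * `|y|).
  by rewrite mulrnAl mulr2n expRD; ring.
by rewrite ler_pM// HK.
Qed.

Lemma cov_itv_integrable (D : set (measurableTypeR R)) t x y :
  measurable D -> D `<=` `]-oo, t] ->
  leb.-integrable D
    (EFin \o (fun r => ip (adjoint_path t x r) (adjoint_path t y r))).
Proof.
move=> mD Dt; have [g ig Hg] := cov_integrable t.
apply: (@integrableS _ _ _ leb `]-oo, t]%classic D) => //.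
apply: (@le_integrable _ _ _ leb `]-oo, t]%classic (measurable_itv _) _
  (fun r => (g r * (`|x| * `|y|))%:E)).
- apply/measurable_EFinP/(weakly_measurable_ip hip hsep);
    exact: weakly_measurable_adjoint_path.
- move=> r /=; rewrite in_itv/= => rt.
  by rewrite lee_fin (le_trans (Hg _ _ _ rt))// ler_norm.
- by apply: integrable_EFinZr => //; exact: measurable_itv.
Qed.

(** The integral of the form is linear and bounded in [y], hence represented by a
    vector: the weak integral exists and is not the default value. *)
Lemma cov_vintegralP (D : set (measurableTypeR R)) t x y :
  measurable D -> D `<=` `]-oo, t] ->
  ip (vintegral ip D (fun r => cov_integrand ip U B t r x)) y =
  \int[leb]_(r in D) ip (adjoint_path t x r) (adjoint_path t y r).
Proof.
move=> mD Dt.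
have E z : {in D, (fun r => ip (cov_integrand ip U B t r x) z) =1
    (fun r => ip (adjoint_path t x r) (adjoint_path t z r))}.
  move=> r; rewrite inE => /Dt /=; rewrite in_itv/= => rt.
  exact: ip_cov_integrand.
have iD z := @cov_itv_integrable D t x z mD Dt.
pose f z := \int[leb]_(r in D) ip (adjoint_path t x r) (adjoint_path t z r).
have flin k a b : f (k *: a + b) = k * f a + f b.
  have ika : leb.-integrable D
      (EFin \o (fun r => ip (adjoint_path t x r) (adjoint_path t a r) * k)).
    exact: (@integrable_EFinZr _ _ R leb D _ k mD (iD a)).
  rewrite /f mulrC -(RintegralZr k mD (iD a)) -(RintegralD mD ika (iD b)).
  apply: eq_Rintegral => r; rewrite inE => /Dt /=; rewrite in_itv/= => rt.
  by rewrite -!ip_cov_integrand// ipDr ipZr mulrC.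
have [g ig Hg] := cov_integrable t.
have fbnd z : `|f z| <= (\int[leb]_(r in D) g r * `|x|) * `|z|.
  have igD : leb.-integrable D (EFin \o g).
    by apply: (@integrableS _ _ _ leb `]-oo, t]%classic D).
  apply: le_trans (le_normr_Rintegral _ _) _ => //.
  rewrite -mulrA -RintegralZr//; apply: le_Rintegral => //.
  - exact: (integrable_norm (iD z)).
  - exact: integrable_EFinZr.
  - by move=> r /Dt /=; rewrite in_itv/= => rt; exact: Hg.
have [v vP] := riesz_representation hip flin fbnd.
have exv : exists v, forall z,
    leb.-integrable D (fun r => (ip (cov_integrand ip U B t r x) z)%:E) /\
    ip v z = \int[leb]_(r in D) ip (cov_integrand ip U B t r x) z.
  exists v => z; split.
    apply: eq_integrable (iD z) => // r rD; by rewrite E.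
  by rewrite -vP; apply: eq_Rintegral => r rD; rewrite E.
have [_ ->] := xgetPex 0 exv y.
by apply: eq_Rintegral; exact: E.
Qed.

Lemma cov_nonneg_selfadjoint (D : set (measurableTypeR R)) t :
  measurable D -> D `<=` `]-oo, t] ->
  nonneg_selfadjoint ip
    (fun x => vintegral ip D (fun r => cov_integrand ip U B t r x)).
Proof.
move=> mD Dt; split => [x y|x].
  rewrite (ipC ip x) !cov_vintegralP//.
  by apply: eq_Rintegral => r _; rewrite ipC.
by rewrite cov_vintegralP//; apply: Rintegral_ge0 => r _; exact: ip_ge0.
Qed.

Lemma Qop_le_ninfty t s h :
  0 <= ip (Qop ip U B t s h) h <= ip (Qop_ninfty ip U B t h) h.
Proof.
have sub : `[s, t] `<=` (`]-oo, t] : set R) by apply: subset_itvr.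
rewrite /Qop /Qop_ninfty !cov_vintegralP//; apply/andP; split.
  by apply: Rintegral_ge0 => r _; exact: ip_ge0.
have i1 := @cov_itv_integrable `[s, t] t h h (measurable_itv _) sub.
have i2 := @cov_itv_integrable `]-oo, t] t h h (measurable_itv _) (@subset_refl _ _).
apply: fine_le; try exact: integrable_fin_num.
apply: ge0_subset_integral => //.
- by case/integrableP: i2.
- by move=> r _; rewrite lee_fin ip_ge0.
Qed.

Lemma cvg_Qop t h (s_ : nat -> R) : s_ n @[n --> \oo] --> -oo ->
  ip (Qop ip U B t (s_ n) h) h @[n --> \oo] --> ip (Qop_ninfty ip U B t h) h.
Proof.
move=> sNy.
have sub s : `[s, t] `<=` (`]-oo, t] : set R) by apply: subset_itvr.
rewrite /Qop_ninfty cov_vintegralP//.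
pose q r := ip (adjoint_path t h r) (adjoint_path t h r).
have E n : ip (Qop ip U B t (s_ n) h) h =
    \int[leb]_(r in `]-oo, t]) (q \_ `[s_ n, t]) r.
  rewrite /Qop cov_vintegralP// -Rintegral_mkcondr; congr (\int[leb]_(r in _) q r).
  by rewrite setIidr.
under eq_fun do rewrite E.
have i2 := @cov_itv_integrable `]-oo, t] t h h (measurable_itv _) (@subset_refl _ _).
have mq : measurable_fun (`]-oo, t] : set (measurableTypeR R)) q.
  by apply: (weakly_measurable_ip hip hsep); exact: weakly_measurable_adjoint_path.
apply: (@dominated_Rintegral _ _ R leb `]-oo, t] (fun n => q \_ `[s_ n, t]) q q) => //.
- move=> n; apply/measurable_restrict => //.
  by apply: measurable_funS mq => //; rewrite setIidr.
- move=> r /=; rewrite in_itv/= => rt; apply: cvg_near_cst.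
  have /cvgrNy_le/(_ r) snr := sNy; near=> n.
  have s_r : s_ n <= r by near: n; exact: snr.
  by rewrite patchE mem_set//= in_itv/= s_r.
- move=> n r _; rewrite patchE; case: ifP => _; last by rewrite normr0 ip_ge0.
  by rewrite ger0_norm ?ip_ge0.
Unshelve. all: by end_near. Qed.

End covariance.

(** * The transition operator on Lipschitz cylinder functions *)

Section trigonometric_lipschitz.
Context {R : realType}.

Lemma lipschitz_of_derive (f df : R -> R) (a b : R) :
  (forall x : R, is_derive x 1 f (df x)) -> (forall x, `|df x| <= 1) ->
  `|f a - f b| <= `|a - b|.
Proof.
move=> dfP df1.
wlog ab : a b / b <= a.
  by move=> h; have [/h//|/ltW/h] := leP b a; rewrite distrC (distrC b).
have [|c _ ->] := @MVT_segment R f df b a ab (fun x _ => dfP x).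
  apply: continuous_subspaceT => x.
  exact/differentiable_continuous/derivable1_diffP.
by rewrite normrM ler_piMl.
Qed.

Lemma cos_lipschitz (a b : R) : `|cos a - cos b| <= `|a - b|.
Proof.
by apply: (lipschitz_of_derive (df := fun x => - sin x)) => x; rewrite normrN sin_abs_le1.
Qed.

Lemma sin_lipschitz (a b : R) : `|sin a - sin b| <= `|a - b|.
Proof. by apply: (lipschitz_of_derive (df := cos)) => x; exact: cos_max. Qed.

Lemma lipschitz_continuous (f : R -> R) (C : R) :
  (forall a b, `|f a - f b| <= C * `|a - b|) -> continuous f.
Proof.
move=> fC x; apply/cvgrPdist_le => e e0; near=> y.
apply: le_trans (fC _ _) _.
apply: (@le_trans _ _ ((`|C| + 1) * `|x - y|)).
  by rewrite ler_wpM2r// (le_trans (ler_norm C))// lerDl.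
rewrite mulrC -ler_pdivlMr; last by rewrite ltr_wpDl.
near: y; apply: cvgr_dist_le; first exact: cvg_id.
by rewrite divr_gt0// ltr_wpDl.
Unshelve. all: by end_near. Qed.

End trigonometric_lipschitz.

(** The Markov inequality in pointwise form, valid for moments of any positive
    order [K]. *)
Lemma min2_le_powR (R : realType) (u e K : R) : 0 < e -> 0 < K -> 0 <= u ->
  Num.min u 2 <= e + 2 * (u / e) `^ K.
Proof.
move=> e0 K0 u0; have p0 := powR_ge0 (u / e) K.
have [ue|eu] := leP u e.
  by rewrite ge_min; apply/orP; left; lra.
rewrite ge_min; apply/orP; right.
suff : 1 `^ K <= (u / e) `^ K by rewrite powR1; lra.
apply: ge0_ler_powR; rewrite ?nnegrE ?ltW//.
  by rewrite divr_gt0// (lt_trans e0).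
by rewrite ltr_pdivlMr// mul1r.
Qed.

Section transition_gap.
Context {R : realType} {X : completeNormedModType R} (ip : {dot X for idfun}).
Hypothesis hip : inner_product_of_norm ip.
Variables (g : R -> R) (L : R) (h : X).
Hypothesis g_lip : forall a b, `|g a - g b| <= L * `|a - b|.
Hypothesis g_le1 : forall a, `|g a| <= 1.

Lemma measurable_ip :
  measurable_fun [set: borel X] (fun x : borel X => ip x h : measurableTypeR R).
Proof. by apply: continuous_borel_measurable; exact: ip_continuous. Qed.

Lemma bounded_measurable_lip_ip a :
  bounded_measurable (fun y : borel X => g (a + ip y h)).
Proof.
split; last by exists 1.
apply: (measurableT_comp (f := (g : measurableTypeR R -> measurableTypeR R))).
  apply: continuous_measurable_fun; exact: lipschitz_continuous g_lip.
by apply: measurable_funD => //; exact: measurable_ip.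
Qed.

Lemma Cb_lip_ip : Cb (fun x : X => g (ip x h)).
Proof.
split; last by exists 1.
move=> x; apply: continuous_comp; first exact: ip_continuous.
exact: lipschitz_continuous g_lip _.
Qed.

(** The integrand of [nu] is [G <T x, h>] with [G] both [L]-Lipschitz and bounded by
    1, so its distance to [G 0] is at most [min (L D |h| |x|) 2], which
    [min2_le_powR] bounds by an affine function of [|x| ^ K]. *)
Lemma transition_gap (nu gam : probability (borel X) R) (T : {linear X -> X})
    (D C e K : R) :
  continuous T -> (forall x, `|T x| <= D * `|x|) -> 0 < e -> 0 < K ->
  (\int[nu]_x (`|x : X| `^ K)%:E <= C%:E)%E ->
  `|\int[nu]_x (\int[gam]_y g (ip (T x + y) h)) - \int[gam]_y g (ip y h)| <=
  e + 2 * (L * D * `|h| / e) `^ K * C.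
Proof.
move=> cT TD e0 K0 momC.
have L0 : 0 <= L by have := g_lip 1 0; rewrite subr0 normr1 mulr1; exact: le_trans.
(* In the zero space nothing forces the constant [D] to be nonnegative. *)
have D0 : 0 <= D \/ forall x : X, x = 0.
  have [x0|] := pselect (exists x : X, x != 0).
    left; have [x x0'] := x0; have nx : 0 < `|x| by rewrite normr_gt0.
    rewrite -(pmulr_lge0 _ nx); exact: le_trans (TD x).
  by move=> /forallNP nx; right => x; apply/eqP/negPn/negP/nx.
pose G a := \int[gam]_y g (a + ip y h).
have G_lip a b : `|G a - G b| <= L * `|a - b|.
  have ia := bounded_measurable_integrable gam (bounded_measurable_lip_ip a).
  have ib := bounded_measurable_integrable gam (bounded_measurable_lip_ip b).
  rewrite /G -RintegralB//; apply: Rintegral_norm_le.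
    under eq_fun do rewrite -mulN1r.
    apply: bounded_measurableD; first exact: bounded_measurable_lip_ip.
    apply: bounded_measurableM; first exact: bounded_measurable_cst.
    exact: bounded_measurable_lip_ip.
  move=> y; apply: le_trans (g_lip _ _) _.
  by rewrite opprD addrACA subrr addr0.
have G_le1 a : `|G a| <= 1.
  by apply: Rintegral_norm_le => //; exact: bounded_measurable_lip_ip.
have G_le a : `|G a - G 0| <= Num.min (L * `|a|) 2.
  rewrite le_min; apply/andP; split; first by have := G_lip a 0; rewrite subr0.
  by apply: le_trans (ler_normB _ _) _; have := G_le1 a; have := G_le1 0; lra.
have E1 x : \int[gam]_y g (ip (T x + y) h) = G (ip (T x) h).
  by apply: eq_Rintegral => y _; rewrite ipDl.
have E0 : \int[gam]_y g (ip y h) = G 0.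
  by apply: eq_Rintegral => y _; rewrite add0r.
rewrite E0; under eq_Rintegral do rewrite E1.
have bG : bounded_measurable (fun x : borel X => G (ip (T x) h)).
  split; last by exists 1.
  apply: continuous_borel_measurable => x.
  have cTh : {for x, continuous (fun x => ip (T x) h)}.
    exact: (@continuous_comp _ _ _ T (fun z => ip z h) x (@cT x)
      (@ip_continuous _ _ _ hip h (T x))).
  have cG : continuous G := lipschitz_continuous G_lip.
  exact: (@continuous_comp _ _ _ (fun x => ip (T x) h) G x cTh (@cG _)).
have bG0 : bounded_measurable (fun x : borel X => G (ip (T x) h) - G 0).
  by apply: bounded_measurableD => //; exact: bounded_measurable_cst.
have iG := bounded_measurable_integrable nu bG.
have iG0 := bounded_measurable_integrable nu bG0.
have cst1 := Rintegral_probability_cst nu.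
rewrite -[G 0 in X in `|X|]cst1 -RintegralB//; last first.
  exact: bounded_measurable_integrable (bounded_measurable_cst _ _).
apply: le_trans (le_normr_Rintegral _ iG0) _ => //.
pose k := (L * D * `|h| / e) `^ K.
have mK : measurable_fun [set: borel X] (fun x : borel X => `|x : X| `^ K).
  apply: (measurableT_comp (f := (fun r : measurableTypeR R => r `^ K))).
    exact: measurable_powR.
  by apply: continuous_borel_measurable; exact: norm_continuous.
have iK : nu.-integrable setT (EFin \o (fun x : borel X => `|x : X| `^ K)).
  apply/integrableP; split; first exact/measurable_EFinP.
  under eq_integral do rewrite /= ger0_norm ?powR_ge0//.
  exact: le_lt_trans momC (ltry _).
have ike : nu.-integrable setT
    (EFin \o (fun x : borel X => e + `|x : X| `^ K * (2 * k))).
  pose m (x : borel X) : R := `|x : X| `^ K * (2 * k).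
  rewrite (_ : EFin \o _ = ((EFin \o cst e) \+ (EFin \o m))%E) //.
  apply: integrableD => //.
    exact: bounded_measurable_integrable (bounded_measurable_cst _ e).
  exact: (@integrable_EFinZr _ _ R nu setT (fun x : borel X => `|x : X| `^ K)).
apply: (@le_trans _ _ (\int[nu]_x (e + `|x : X| `^ K * (2 * k)))).
  apply: le_Rintegral => //; first exact: integrable_norm.
  move=> x _; apply: le_trans (G_le _) _.
  have u0 : 0 <= L * `|ip (T x) h| by rewrite mulr_ge0.
  apply: le_trans (min2_le_powR e0 K0 u0) _.
  rewrite lerD2l mulrCA ler_wpM2l// [leRHS]mulrC /k.
  have [D0'|X0] := D0; last first.
    rewrite (X0 (T x)) ip0l normr0 mulr0 mul0r powR0 ?gt_eqF//.
    by rewrite mulr_ge0 ?powR_ge0.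
  have d0 : 0 <= L * D * `|h| / e by rewrite !mulr_ge0 ?invr_ge0 ?(ltW e0).
  rewrite -powRM//; apply: ge0_ler_powR; rewrite ?nnegrE ?(ltW K0)//.
  - by rewrite divr_ge0// ltW.
  - by rewrite mulr_ge0.
  rewrite [leRHS]mulrAC ler_wpM2r ?invr_ge0 ?(ltW e0)// -!mulrA ler_wpM2l//.
  apply: le_trans (ip_norm_le hip _ _) _.
  by rewrite (mulrC `|h|) mulrA ler_wpM2r.
rewrite RintegralD//; last 2 first.
- exact: bounded_measurable_integrable (bounded_measurable_cst _ e).
- exact: (@integrable_EFinZr _ _ R nu setT (fun x : borel X => `|x : X| `^ K)).
rewrite cst1 lerD2l RintegralZr// mulrC ler_wpM2l ?mulr_ge0 ?powR_ge0//.
rewrite -lee_fin; apply: le_trans momC.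
by rewrite /Rintegral fineK// integrable_fin_num.
Qed.

End transition_gap.

(** * Laws determined by their Fourier transform *)

Lemma characteristic_unique_real (R : realType)
    (P Q : probability (measurableTypeR R) R) :
  (forall c : R, \int[P]_z cos (c * z) = \int[Q]_z cos (c * z)) ->
  (forall c : R, \int[P]_z sin (c * z) = \int[Q]_z sin (c * z)) ->
  forall A, measurable A -> P A = Q A.
Proof.
move=> ec es A mA.
pose H : set (measurableTypeR R -> R) := [set f | exists c : R, f = *%R c].
have mH f : H f -> measurable_fun setT f.
  by move=> [c ->]; apply: measurable_funM.
have HD f g : H f -> H g -> H (fun x => f x + g x).
  by move=> [c ->] [b ->]; exists (c + b); apply/funext => x; rewrite mulrDl.
have HZ k f : H f -> H (fun x => k * f x).
  by move=> [c ->]; exists (k * c); apply/funext => x; rewrite mulrA.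
have H0 : H (cst 0) by exists 0; apply/funext => x; rewrite mul0r.
have Hc f : H f -> \int[P]_x cos (f x) = \int[Q]_x cos (f x).
  by move=> [c ->]; exact: ec.
have Hs f : H f -> \int[P]_x sin (f x) = \int[Q]_x sin (f x).
  by move=> [c ->]; exact: es.
apply: (fourier_unique mH H0 Hc Hs (G := @RGenOInfty.G R)) => [_ [a ->]|].
  rewrite (_ : `]a, +oo[%classic = [set x : measurableTypeR R | a < id x]).
    apply: (agree_sets_gt mH HD HZ Hc Hs); exists 1.
    by apply/funext => x; rewrite mul1r.
  by apply/seteqP; split => x /=; rewrite in_itv/= andbT.
have /(congr1 (fun S : set (set R) => S A)) mE := RGenOInfty.measurableE R.
by have : (@ocitv R).-sigma.-measurable A by []; rewrite mE.
Qed.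

Section hilbert_laws.
Context {R : realType} {X : completeNormedModType R} (ip : {dot X for idfun}).
Hypothesis hip : inner_product_of_norm ip.

Lemma characteristic_unique_hilbert (P Q : probability (borel X) R) :
  @separable R X ->
  (forall h, \int[P]_x cos (ip x h) = \int[Q]_x cos (ip x h)) ->
  (forall h, \int[P]_x sin (ip x h) = \int[Q]_x sin (ip x h)) ->
  forall A, measurable A -> P A = Q A.
Proof.
move=> hsep ec es A mA.
pose H : set (borel X -> R) := [set f | exists h, f = ip^~ h].
have mH f : H f -> measurable_fun setT f.
  by move=> [h ->]; exact: measurable_ip.
have HD f g : H f -> H g -> H (fun x => f x + g x).
  by move=> [a ->] [b ->]; exists (a + b); apply/funext => x; rewrite ipDr.
have HZ k f : H f -> H (fun x => k * f x).
  by move=> [c ->]; exists (k *: c); apply/funext => x; rewrite ipZr.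
have H0 : H (cst 0) by exists 0; apply/funext => x; rewrite ip0r.
have Hc f : H f -> \int[P]_x cos (f x) = \int[Q]_x cos (f x).
  by move=> [c ->]; exact: ec.
have Hs f : H f -> \int[P]_x sin (f x) = \int[Q]_x sin (f x).
  by move=> [c ->]; exact: es.
apply: (fourier_unique mH H0 Hc Hs (G := halfspaces ip)).
  by move=> _ [h [c ->]]; apply: (agree_sets_gt mH HD HZ Hc Hs); exists h.
exact: borel_halfspaces.
Qed.

Lemma gaussian_marginal (mu : probability (borel X) R) (Q : X -> X) h
    (g : measurableTypeR R -> R) :
  is_gaussian ip mu 0 Q -> bounded_measurable g ->
  \int[mu]_x g (ip x h) = \int[normal_law_probability (ip (Q h) h)]_z g z.
Proof.
move=> [_ muQ] bg; have [L LE Lint] := law_exists mu (measurable_ip hip h).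
rewrite -Lint//; apply: eq_law_Rintegral => A mA.
by rewrite LE muQ// ip0l normal_law_probabilityE.
Qed.

End hilbert_laws.

(** * Marginals of an evolution system of measures *)

Section evolution_marginals.
Context {R : realType} {X : completeNormedModType R} (ip : {dot X for idfun}).
Hypothesis hip : inner_product_of_norm ip.
Hypothesis hsep : @separable R X.
Variable U : R -> R -> {linear X -> X}.
Hypothesis hU : evolution_operator U.
Hypothesis homega0 : (ereal_inf (EFin @` growth_rates U) < 0)%E.
Variable B : R -> {linear X -> X}.
Hypothesis hBcont : forall t, continuous (B t).
Hypothesis hBbnd : exists C : R, forall t, opnorm (B t) <= C.
Hypothesis hBmeas : forall x, measurable_fun [set: measurableTypeR R]
  (fun t : measurableTypeR R => B t x : borel X).
Variable gam : R -> R -> probability (borel X) R.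
Hypothesis hgam : forall s t, s <= t ->
  is_gaussian ip (gam t s) 0 (Qop ip U B t s).
Variable nu : R -> probability (borel X) R.
Hypothesis hnu : evolution_system_of_measures U gam nu.
Variable t : R.
Hypothesis hmoment : exists2 K : R, 0 < K &
  (ereal_sup [set \int[nu r]_(x in [set: borel X]) (`|x : X| `^ K)%R%:E
              | r in [set r : R | (r <= t)%R]] < +oo)%E.

Lemma moment_bound : exists K C : R, [/\ 0 < K, 0 <= C & forall r, r <= t ->
  (\int[nu r]_x (`|x : X| `^ K)%:E <= C%:E)%E].
Proof.
have [K K0] := hmoment; set S := [set _ | _ in _] => supS.
have [C [C0 CS]] : exists C, 0 <= C /\ (ereal_sup S <= C%:E)%E.
  case: (ereal_sup S) supS => [c _| |_] //.
    by exists `|c|; split => //; rewrite lee_fin ler_norm.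
  by exists 0; split => //; rewrite leNye.
exists K, C; split => // r rt; apply: le_trans CS.
by apply: ereal_sup_ubound; exists r.
Qed.

Lemma cvg_sub_succ_Ny : t - n.+1%:R @[n --> \oo] --> -oo.
Proof.
apply/cvgrNyPle => A; near=> n.
rewrite lerBlDr -lerBlDl (le_trans (y := n%:R))//; last by rewrite ler_nat.
near: n; exact: nbhs_infty_ger.
Unshelve. all: by end_near. Qed.

(** The integral against [nu t] does not depend on [s], whereas along
    [s = t - n - 1] it is within [transition_gap] of the integral against the normal
    law of variance [<Q(t, s) h, h>]. *)
Lemma evolution_marginal (g : R -> R) (L : R) (h : X) :
  (forall a b, `|g a - g b| <= L * `|a - b|) -> (forall a, `|g a| <= 1) ->
  \int[nu t]_x g (ip x h) =
  \int[normal_law_probability (ip (Qop_ninfty ip U B t h) h)]_z g z.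
Proof.
move=> gL g1.
have bg : @bounded_measurable _ (measurableTypeR R) R g.
  split; last by exists 1.
  apply: continuous_measurable_fun; exact: lipschitz_continuous gL.
pose s n : R := t - n.+1%:R.
have st n : s n < t by rewrite ltrBlDr ltrDl.
pose I n := \int[gam t (s n)]_y g (ip y h).
have IE n : I n = \int[normal_law_probability (ip (Qop ip U B t (s n) h) h)]_z g z.
  exact: (gaussian_marginal hip h (hgam (ltW (st n))) bg).
have I1 : I n @[n --> \oo] -->
    \int[normal_law_probability (ip (Qop_ninfty ip U B t h) h)]_z g z.
  under eq_fun do rewrite IE.
  apply: cvg_normal_law => //.
    by move=> n; exact: Qop_le_ninfty.
  by apply: cvg_Qop => //; exact: cvg_sub_succ_Ny.
apply: (cvg_unique _ _ I1) => //.
have [K [C [K0 C0 HC]]] := moment_bound.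
have [M [c [M0 c0 HM]]] := exponential_stability homega0.
have L0 : 0 <= L by have := gL 1 0; rewrite subr0 normr1 mulr1; exact: le_trans.
pose D n := M * expR (c * (s n - t)).
have gap e n : 0 < e ->
    `|\int[nu t]_x g (ip x h) - I n| <= e + 2 * (L * D n * `|h| / e) `^ K * C.
  move=> e0.
  have cUn : continuous (U t (s n)) by case: hU => + _ _ _; apply; exact: ltW.
  have UD x : `|U t (s n) x| <= D n * `|x|.
    by apply: le_trans (opnorm_le x cUn) _; rewrite ler_wpM2r// HM// ltW.
  have := transition_gap hip h gL g1 (gam t (s n)) cUn UD e0 K0 (HC _ (ltW (st n))).
  by rewrite -(hnu (st n) (Cb_lip_ip hip h gL g1)).
have D0 : (L * D n * `|h|) @[n --> \oo] --> 0.
  have -> : 0 = L * (M * 0) * `|h| :> R by rewrite !(mulr0, mul0r).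
  apply: cvgM; last exact: cvg_cst.
  apply: cvgM; first exact: cvg_cst.
  apply: cvgM; first exact: cvg_cst.
  have -> : (fun n => expR (c * (s n - t))) =
      (fun z => expR (- z)) \o (fun n => c * n.+1%:R).
    by apply/funext => n /=; rewrite /s addrAC subrr add0r mulrN.
  have ny : (n.+1%:R : R) @[n --> \oo] --> +oo.
    by rewrite (cvg_shiftS (fun n => n%:R : R)); exact: cvgr_idn.
  have cM : c * x @[x --> +oo] --> +oo.
    by apply: (@gt0_cvgMry R (pinfty_nbhs R) _ c id) => //; exact: cvg_id.
  have cny : c * n.+1%:R @[n --> \oo] --> +oo by exact: (cvg_comp _ _ ny cM).
  exact: (cvg_comp _ _ cny (@cvgr_expR R)).
apply/cvgrPdist_le => e e0.
pose d := e / 2.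
have d0 : 0 < d by rewrite divr_gt0.
(* [u <= rho] is equivalent to [u `^ K <= d / (2 * (C + 1))], the bound that makes
   the moment term of the gap at most [d]. *)
pose rho := (d / (2 * (C + 1))) `^ K^-1.
have rho0 : 0 < rho by rewrite powR_gt0// divr_gt0// mulr_gt0// ltr_wpDl.
near=> n.
apply: le_trans (gap d n d0) _.
have rn : L * D n * `|h| / d <= rho.
  rewrite ler_pdivrMr//; near: n.
  exact: (cvgr_le _ D0 _ (mulr_gt0 rho0 d0)).
have Dn0 : 0 <= L * D n * `|h| / d.
  by rewrite !mulr_ge0 ?invr_ge0 ?expR_ge0 ?(ltW M0) ?(ltW d0).
have : (L * D n * `|h| / d) `^ K <= d / (2 * (C + 1)).
  apply: (@le_trans _ _ (rho `^ K)).
    by apply: ge0_ler_powR; rewrite ?nnegrE// ltW.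
  rewrite /rho -powRrM mulVf ?gt_eqF// powRr1// divr_ge0 ?(ltW d0)//.
  by rewrite mulr_ge0// addr_ge0.
set p := _ `^ K => pd.
have p0 : 0 <= p by exact: powR_ge0.
have C1 : 0 < 2 * (C + 1) by rewrite mulr_gt0// ltr_wpDl.
rewrite ler_pdivlMr// in pd.
have de : e = d + d by rewrite /d; field.
rewrite [leRHS]de lerD2l; nra.
Unshelve. all: by end_near. Qed.

(** The functions [cos (c z)] and [sin (c z)] are bounded and Lipschitz, and their
    integrals determine the law of [<x, h>]. *)
Lemma invariant_is_gaussian : is_gaussian ip (nu t) 0 (Qop_ninfty ip U B t).
Proof.
split.
  exact: (cov_nonneg_selfadjoint hip hsep hU homega0 hBcont hBbnd hBmeas
    (measurable_itv _) (@subset_refl _ _)).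
move=> h V mV; have [L LE Lint] := law_exists (nu t) (measurable_ip hip h).
rewrite -LE ip0l normal_law_probabilityE.
have lip f (c : R) : (forall a b : R, `|f a - f b| <= `|a - b|) ->
    forall a b : R, `|f (c * a) - f (c * b)| <= `|c| * `|a - b|.
  by move=> fl a b; rewrite -normrM mulrBr; exact: fl.
have mc (c : R) : measurable_fun [set: measurableTypeR R]
    (fun z : measurableTypeR R => c * z) by exact: measurable_funM.
apply: characteristic_unique_real => // c.
- rewrite (Lint (fun z => cos (c * z))); last by apply: bounded_measurable_cos; exact: mc.
  apply: (evolution_marginal (g := fun z => cos (c * z))) => [|a].
    exact/lip/cos_lipschitz.
  exact: cos_max.
- rewrite (Lint (fun z => sin (c * z))); last by apply: bounded_measurable_sin; exact: mc.
  apply: (evolution_marginal (g := fun z => sin (c * z))) => [|a].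
    exact/lip/sin_lipschitz.
  exact: sin_abs_le1.
Qed.

End evolution_marginals.

Theorem proposition20 (R : realType) (X : completeNormedModType R)
  (ip : {dot X for idfun})
  (hip : inner_product_of_norm ip)
  (hsep : @separable R X)
  (domA : R -> set X) (A : R -> X -> X)
  (hA : forall t, linear_on_domain (domA t) (A t))
  (U : R -> R -> {linear X -> X})
  (hU : evolution_operator U)
  (hAU : generates U domA A)
  (hOmega : growth_rates U !=set0)
  (homega0 : (ereal_inf (EFin @` growth_rates U) < 0)%E)
  (B : R -> {linear X -> X})
  (hBcont : forall t, continuous (B t))
  (hBbnd : exists C : R, forall t, opnorm (B t) <= C)
  (hBmeas : forall x, measurable_fun [set: measurableTypeR R]
     (fun t : measurableTypeR R => B t x : borel X))
  (hQtc : forall s t, s <= t -> trace_class ip (Qop ip U B t s))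
  (hQsup : forall t : R, (ereal_sup
     [set trace ip (Qop ip U B t s) | s in [set s : R | (s <= t)%R]] < +oo)%E)
  (hctrl : forall s t, s < t ->
     range (U t s) `<=` range (opsqrt ip (Qop ip U B t s)))
  (gam : R -> R -> probability (borel X) R)
  (hgam : forall s t, s <= t -> is_gaussian ip (gam t s) 0 (Qop ip U B t s))
  (nu : R -> probability (borel X) R)
  (hnu : evolution_system_of_measures U gam nu)
  (t : R)
  (hmoment : exists2 K : R, 0 < K &
     (ereal_sup [set \int[nu r]_(x in [set: borel X]) (`|x : X| `^ K)%R%:E
                | r in [set r : R | (r <= t)%R]] < +oo)%E) :
  is_gaussian ip (nu t) 0 (Qop_ninfty ip U B t) /\
  (forall mu : probability (borel X) R,
     is_gaussian ip mu 0 (Qop_ninfty ip U B t) ->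
     forall V : set (borel X), measurable V -> nu t V = mu V).
Proof.
have nuG := invariant_is_gaussian hip hsep hU homega0 hBcont hBbnd hBmeas hgam
  hnu hmoment.
split => // mu muG; apply: (characteristic_unique_hilbert hip hsep) => h.
- rewrite (gaussian_marginal (g := cos) hip h nuG).
    by rewrite (gaussian_marginal (g := cos) hip h muG)//; exact: bounded_measurable_cos.
  exact: bounded_measurable_cos.
- rewrite (gaussian_marginal (g := sin) hip h nuG).
    by rewrite (gaussian_marginal (g := sin) hip h muG)//; exact: bounded_measurable_sin.
  exact: bounded_measurable_sin.
Qed.
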